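(* There exists a measure $\mu\in\mathcal{M}_{\mathrm{loc},\mathrm{unif}}(\mathbb{R})$ such that $-1$ is an eigenvalue of $H_\mu$, $\mu$ is a weak Gordon measure with weight $C$ for all $0<C<1$, and $\inf_{r>0}\|\mu\|_{\mathrm{unif},r}=0$. For this measure one has $C_\mu=1$ and $E_\mu=1$, where $$C_\mu:=-\liminf_{p\to\infty}\frac1p\ln\|\mu-\mu(\cdot+p)\|_{[-p,p]},\qquad E_\mu:=C_\mu^2-\inf_{r>0}\|\mu\|_{\mathrm{unif},r}.$$
   Context: A local measure on $\mathbb{R}$ is a map $\mu$ from the bounded Borel subsets of $\mathbb{R}$ to $\mathbb{C}$ such that $\mathbf{1}_K\mu:=\mu(\cdot\cap K)$ is a complex Radon measure for every compact $K\subseteq\mathbb{R}$; $|\mu|$ denotes its total variation (a nonnegative Radon measure on $\mathbb{R}$). Put $\|\mu\|_{\mathrm{unif}}:=\sup_{a\in\mathbb{R}}|\mu|((a,a+1])$, and let $\mathcal{M}_{\mathrm{loc},\mathrm{unif}}(\mathbb{R})$ be the space of all local measures $\mu$ with $\|\mu\|_{\mathrm{unif}}<\infty$. For $r>0$ put $\|\mu\|_{\mathrm{unif},r}:=\frac1r\sup_{a\in\mathbb{R}}|\mu|((a,a+r])$. Let $W^1_\infty(\mathbb{R})$ denote the (complex-valued) Lipschitz continuous functions on $\mathbb{R}$. For $\mu\in\mathcal{M}_{\mathrm{loc},\mathrm{unif}}(\mathbb{R})$ and $I\subseteq\mathbb{R}$ define $$\|\mu\|_I:=\sup\Bigl\{\Bigl|\int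 u\,d\mu\Bigr| : u\in W^1_\infty(\mathbb{R}),\ \operatorname{spt}u\subseteq I,\ \operatorname{diam}\operatorname{spt}u\le 2,\ \|u'\|_\infty\le 1\Bigr\}.$$ For $p\in\mathbb{R}$, $\mu(\cdot+p)$ denotes the translate $B\mapsto\mu(B+p)$. For $C>0$, $\mu$ is called a weak Gordon measure with weight $C$ if there is a sequence $(p_m)$ in $(0,\infty)$ with $p_m\to\infty$ and $\lim_{m\to\infty}e^{Cp_m}\|\mu-\mu(\cdot+p_m)\|_{[-p_m,p_m]}=0$. Convention: $\ln 0=-\infty$. The operator $H_\mu$ in $L_2(\mathbb{R})$ is defined by $D(H_\mu):=\{u\in L_2(\mathbb{R})\cap C(\mathbb{R}) : -u''+u\mu\in L_2(\mathbb{R})\}$, $H_\mu u:=-u''+u\mu$, in the sense of distributions; i.e. for $u,f\in L_2(\mathbb{R})$, one has $u\in D(H_\mu)$ and $H_\mu u=f$ iff $u$ is continuous and $\int_{\mathbb{R}}f\varphi=-\int_{\mathbb{R}}u\varphi''+\int_{\mathbb{R}}u\varphi\,d\mu$ for all $\varphi\in C_c^\infty(\mathbb{R})$. *)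

(* Defs.v *)
From HB Require Import structures.
From mathcomp Require Import all_boot all_order all_algebra.
From mathcomp Require Import all_classical all_reals all_analysis.
From mathcomp Require Import measurable_realfun ess_sup_inf complex.

Set Implicit Arguments.
Unset Strict Implicit.
Unset Printing Implicit Defensive.

Import Order.TTheory GRing.Theory Num.Theory.
Import numFieldNormedType.Exports.
Import ComplexField.Normc.

Local Open Scope classical_set_scope.
Local Open Scope ring_scope.
Local Open Scope complex_scope.

(** Local measures.  The carrier is a total function on [set R]; it is
    constrained, and used below, on bounded Borel sets only.  A complex measure
    is a set function whose real and imaginary parts are finite signed measures;
    finiteness is automatic since the values are in [R[i]]. *)
Record local_measure (R : realType) := LocalMeasure {
  lm_val :> set (measurableTypeR R) -> R[i] ;
  lm_set0 : lm_val set0 = 0 ;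
  lm_Re : forall K : set R, compact K ->
    semi_sigma_additive
      (fun A : set (measurableTypeR R) => (complex.Re (lm_val (A `&` K)))%:E) ;
  lm_Im : forall K : set R, compact K ->
    semi_sigma_additive
      (fun A : set (measurableTypeR R) => (complex.Im (lm_val (A `&` K)))%:E)
}.

Arguments lm_Re {R} _ [K].
Arguments lm_Im {R} _ [K].

Section local_measure_algebra.
Context {R : realType}.
Implicit Types (mu nu : local_measure R) (p : R).

Definition lm_sub_fun mu nu (A : set (measurableTypeR R)) : R[i] :=
  mu A - nu A.

Lemma lm_sub_set0 mu nu : lm_sub_fun mu nu set0 = 0.
Proof. by rewrite /lm_sub_fun !lm_set0 subrr. Qed.

Lemma ReB (x y : R[i]) : complex.Re (x - y) = complex.Re x - complex.Re y.
Proof. by case: x y => [a b] [c d]. Qed.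

Lemma ImB (x y : R[i]) : complex.Im (x - y) = complex.Im x - complex.Im y.
Proof. by case: x y => [a b] [c d]. Qed.

Lemma semi_sigma_additiveB (f g : set (measurableTypeR R) -> R) :
  semi_sigma_additive (EFin \o f) -> semi_sigma_additive (EFin \o g) ->
  semi_sigma_additive (fun A => (f A - g A)%:E).
Proof.
move=> sf sg F mF tF mUF.
have -> : (fun n => \sum_(0 <= i < n) (f (F i) - g (F i))%:E)%E =
    (fun n => \sum_(0 <= i < n) (EFin \o f) (F i) -
              \sum_(0 <= i < n) (EFin \o g) (F i))%E.
  by apply/funext => n; rewrite !sumEFin -EFinB -sumrB.
by rewrite EFinB; apply: cvgeB => //; [exact: sf|exact: sg].
Qed.

Lemma lm_sub_Re mu nu (K : set R) : compact K ->
  semi_sigma_additive (fun A : set (measurableTypeR R) =>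
    (complex.Re (lm_sub_fun mu nu (A `&` K)))%:E).
Proof.
move=> cK; have -> : (fun A => (complex.Re (lm_sub_fun mu nu (A `&` K)))%:E) =
    (fun A => (complex.Re (mu (A `&` K)) - complex.Re (nu (A `&` K)))%:E).
  by apply/funext => A; rewrite /lm_sub_fun ReB.
by apply: semi_sigma_additiveB; apply: lm_Re.
Qed.

Lemma lm_sub_Im mu nu (K : set R) : compact K ->
  semi_sigma_additive (fun A : set (measurableTypeR R) =>
    (complex.Im (lm_sub_fun mu nu (A `&` K)))%:E).
Proof.
move=> cK; have -> : (fun A => (complex.Im (lm_sub_fun mu nu (A `&` K)))%:E) =
    (fun A => (complex.Im (mu (A `&` K)) - complex.Im (nu (A `&` K)))%:E).
  by apply/funext => A; rewrite /lm_sub_fun ImB.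
by apply: semi_sigma_additiveB; apply: lm_Im.
Qed.

Definition lm_sub mu nu : local_measure R :=
  LocalMeasure (lm_sub_set0 mu nu) (@lm_sub_Re mu nu) (@lm_sub_Im mu nu).

Definition shift_set p (A : set R) : set R := [set x + p | x in A].

Lemma shift_setE p (A : set R) : shift_set p A = (fun x => x - p) @^-1` A.
Proof.
apply/seteqP; split => [x [y Ay <-]|x Ax] /=; first by rewrite addrK.
by exists (x - p) => //; rewrite subrK.
Qed.

Definition lm_translate_fun mu p (A : set (measurableTypeR R)) : R[i] :=
  mu (shift_set p A).

Lemma lm_translate_set0 mu p : lm_translate_fun mu p set0 = 0.
Proof. by rewrite /lm_translate_fun shift_setE preimage_set0 lm_set0. Qed.

Lemma compact_shift p (K : set R) : compact K -> compact (shift_set p K).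
Proof.
move=> cK; apply: continuous_compact => //; apply: continuous_subspaceT => x.
by apply: cvgD; [exact: cvg_id|exact: cvg_cst].
Qed.

Lemma semi_sigma_additive_shift p (f : set (measurableTypeR R) -> \bar R) :
  semi_sigma_additive f -> semi_sigma_additive (fun A => f (shift_set p A)).
Proof.
move=> sf.
have ms (A : set (measurableTypeR R)) :
    measurable A -> measurable (shift_set p A : set (measurableTypeR R)).
  move=> mA; rewrite shift_setE -[X in measurable X]setTI.
  have mB : measurable_fun setT (fun x : measurableTypeR R => (x : R) - p).
    by apply: measurable_funB; [exact: measurable_id|exact: measurable_cst].
  exact: mB.
move=> F mF tF mUF.
have -> : shift_set p (\bigcup_n F n) = \bigcup_n shift_set p (F n).
  exact: image_bigcup.
apply: sf => [i||]; first exact: (ms _ (mF i)).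
- apply/trivIsetP => i j _ _ ij; rewrite !shift_setE -preimage_setI.
  by rewrite ((trivIsetP.1 tF) i j Logic.I Logic.I ij) preimage_set0.
- by apply: bigcupT_measurable => i; exact: (ms _ (mF i)).
Qed.

Lemma lm_translate_Re mu p (K : set R) : compact K ->
  semi_sigma_additive (fun A : set (measurableTypeR R) =>
    (complex.Re (lm_translate_fun mu p (A `&` K)))%:E).
Proof.
move=> /(@compact_shift p) /(lm_Re mu) /(@semi_sigma_additive_shift p) muK.
rewrite (_ : (fun A => _) = (fun A =>
  (complex.Re (mu (shift_set p A `&` shift_set p K)))%:E)) //.
by apply/funext => A; rewrite /lm_translate_fun !shift_setE preimage_setI.
Qed.

Lemma lm_translate_Im mu p (K : set R) : compact K ->
  semi_sigma_additive (fun A : set (measurableTypeR R) =>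
    (complex.Im (lm_translate_fun mu p (A `&` K)))%:E).
Proof.
move=> /(@compact_shift p) /(lm_Im mu) /(@semi_sigma_additive_shift p) muK.
rewrite (_ : (fun A => _) = (fun A =>
  (complex.Im (mu (shift_set p A `&` shift_set p K)))%:E)) //.
by apply/funext => A; rewrite /lm_translate_fun !shift_setE preimage_setI.
Qed.

(** [lm_translate mu p] is the measure mu(. + p) : B |-> mu(B + p). *)
Definition lm_translate mu p : local_measure R :=
  LocalMeasure (lm_translate_set0 mu p)
    (@lm_translate_Re mu p) (@lm_translate_Im mu p).

End local_measure_algebra.

Section restriction_to_compact.
Context {R : realType} (mu : local_measure R) (K : set R) (cK : compact K).

Definition lm_restr_Re & compact K : set (measurableTypeR R) -> \bar R :=
  fun A => (complex.Re (mu (A `&` K)))%:E.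

Definition lm_restr_Im & compact K : set (measurableTypeR R) -> \bar R :=
  fun A => (complex.Im (mu (A `&` K)))%:E.

Let Re0 : lm_restr_Re cK set0 = 0%E.
Proof. by rewrite /lm_restr_Re set0I lm_set0. Qed.

Let Im0 : lm_restr_Im cK set0 = 0%E.
Proof. by rewrite /lm_restr_Im set0I lm_set0. Qed.

Let ReF A : measurable A -> lm_restr_Re cK A \is a fin_num.
Proof. by []. Qed.

Let ImF A : measurable A -> lm_restr_Im cK A \is a fin_num.
Proof. by []. Qed.

HB.instance Definition _ := isCharge.Build _ (measurableTypeR R) R
  (lm_restr_Re cK) Re0 ReF (lm_Re mu cK).

HB.instance Definition _ := isCharge.Build _ (measurableTypeR R) R
  (lm_restr_Im cK) Im0 ImF (lm_Im mu cK).

End restriction_to_compact.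

Section integrals.
Context {R : realType}.

Definition re_part (u : R -> R[i]) (x : R) : R := complex.Re (u x).
Definition im_part (u : R -> R[i]) (x : R) : R := complex.Im (u x).

(** Integral against a finite signed measure, by Jordan decomposition; the
    value does not depend on the chosen Hahn decomposition. *)
Definition charge_int (nu : {charge set (measurableTypeR R) -> \bar R})
    (f : R -> R) : R :=
  let PN := cid (Hahn_decomposition nu) in
  let nuPN := svalP (cid (svalP PN)) in
  Rintegral (jordan_pos nuPN) setT f - Rintegral (jordan_neg nuPN) setT f.

Definition support (u : R -> R[i]) : set R := closure [set x | u x != 0].

(** The integral of a compactly supported [u] against [mu], computed against the
    complex measure 1_K mu with K the support of [u]; junk value 0 when the
    support is not compact. *)
Definition lm_int (mu : local_measure R) (u : R -> R[i]) : R[i] :=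
  match pselect (compact (support u)) with
  | left cK =>
    let mu1 := lm_restr_Re mu cK in
    let mu2 := lm_restr_Im mu cK in
    (charge_int mu1 (re_part u) - charge_int mu2 (im_part u)) +i*
    (charge_int mu1 (im_part u) + charge_int mu2 (re_part u))
  | right _ => 0
  end.

Definition leb_int (f : R -> R[i]) : R[i] :=
  Rintegral lebesgue_measure setT (re_part f) +i*
  Rintegral lebesgue_measure setT (im_part f).

End integrals.

Section measure_norms.
Context {R : realType}.
Implicit Types (mu : local_measure R) (r : R) (A I : set R) (u : R -> R[i]).
Local Open Scope ereal_scope.

(** |mu|(A), for A bounded Borel. *)
Definition total_variation mu A : \bar R :=
  ereal_sup [set x | exists (n : nat) (F : 'I_n -> set (measurableTypeR R)),
    [/\ (forall i, measurable (F i)), trivIset setT F,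
        \bigcup_(i in setT) F i = A &
        x = \sum_(i < n) (normc (mu (F i)))%:E] ].

Definition unif_norm mu : \bar R :=
  ereal_sup [set total_variation mu `]a, (a + 1)%R] | a in [set: R]].

Definition in_Mlocunif mu := unif_norm mu < +oo.

Definition unif_normr mu r : \bar R :=
  (r^-1)%:E *
  ereal_sup [set total_variation mu `]a, (a + r)%R] | a in [set: R]].

Definition inf_unif_normr mu : \bar R :=
  ereal_inf [set unif_normr mu r | r in [set r : R | (0 < r)%R]].

Definition clipschitz u :=
  exists k : R, forall x y, (normc (u x - u y) <= k * `|x - y|)%R.

Definition cderive u (x : R) : R[i] :=
  derive1 (re_part u) x +i* derive1 (im_part u) x.

Definition diam A : \bar R :=
  ereal_sup [set (`|z.1 - z.2|)%:E | z in A `*` A].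

(** The derivative of a Lipschitz function exists almost everywhere; the junk
    values of [cderive] elsewhere are not seen by the essential supremum. *)
Definition local_norm_test I u :=
  [/\ clipschitz u, support u `<=` I, diam (support u) <= 2%:E &
      Lnorm (@lebesgue_measure R) +oo (fun x => (normc (cderive u x))%:E) <= 1].

(** ||mu||_I *)
Definition local_norm mu I : \bar R :=
  ereal_sup [set (normc (lm_int mu u))%:E | u in local_norm_test I].

(** ||mu - mu(. + p)||_{[-p, p]} *)
Definition gordon_gap mu (p : R) : \bar R :=
  local_norm (lm_sub mu (lm_translate mu p)) `[(- p)%R, p].

Definition weak_gordon mu (C : R) :=
  exists p : nat -> R, [/\ (forall m, 0 < p m)%R, p @ \oo --> +oo%R &
    (fun m => (expR (C * p m))%:E * gordon_gap mu (p m)) @ \oo --> 0].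

(** [lne 0 = -oo] *)
Definition Cmu mu : \bar R :=
  - limf_einf (fun p : R => (p^-1)%:E * lne (gordon_gap mu p)) (pinfty_nbhs R).

Definition Emu mu : \bar R := Cmu mu ^+ 2 - inf_unif_normr mu.

End measure_norms.

Section schroedinger.
Context {R : realType}.
Implicit Types (mu : local_measure R) (u f phi : R -> R[i]).

Definition L2 f :=
  [/\ measurable_fun setT (re_part f : measurableTypeR R -> R),
      measurable_fun setT (im_part f : measurableTypeR R -> R) &
      finite_norm (@lebesgue_measure R) 2%:E (fun x => normc (f x))].

Definition ccontinuous u :=
  continuous (re_part u) /\
  continuous (im_part u).

Definition test_function phi :=
  [/\ (forall n x, derivable (derive1n n (re_part phi)) x 1),
      (forall n x, derivable (derive1n n (im_part phi)) x 1) &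
      compact (support phi)].

(** [H_graph mu u f]: u belongs to D(H_mu) and H_mu u = f, with u the continuous
    representative of its class. *)
Definition H_graph mu u f :=
  [/\ L2 u, L2 f, ccontinuous u &
    forall phi, test_function phi ->
      leb_int (fun x => f x * phi x) =
      - leb_int (fun x => u x * cderive (cderive phi) x)
      + lm_int mu (fun x => u x * phi x)].

Definition H_eigenvalue mu (lambda : R[i]) :=
  exists u, ~ {ae (@lebesgue_measure R), forall x, u x = 0} /\
    H_graph mu u (fun x => lambda * u x).

End schroedinger.

(* Main.v *)
From HB Require Import structures.
Require Import Defs.
From mathcomp Require Import all_boot all_order all_algebra.
From mathcomp Require Import all_classical all_reals all_analysis.
From mathcomp Require Import measurable_realfun ess_sup_inf complex.
From mathcomp Require Import zify ring lra.
(* imported again so that [support] is the closed support of a function, not the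
   abbreviation of the same name for the set where it does not vanish *)
Require Import Defs.

(** The measure is a sparse sum of negative point masses, read off from an
    explicit positive function.  Let [q 0 = 4] and [q m.+1 = (21 + m) * q m].
    The atoms are the finite sums [sum_k e_k * q k.+1] with digits [e_k] in
    [{-1, 0, 1, 2}], enumerated by the base-4 expansion of a natural number; each
    atom [y] carries the height [h y], the product of [exp (- 8 * q k)] over its
    nonzero digits [e_k].  The heights have sum at most 2, so
      [u x = sum_y h y * exp (- |x - y|)]
    is a bounded, Lipschitz, square integrable positive function, and
    [- u'' + u = 2 * sum_y h y * \d_y].  Hence [- u'' + u mu = - u] for
    [mu = sum_y a y * \d_y] with [a y = - 2 * h y / u y]: the number -1 is an
    eigenvalue of [H_mu] ([gordon_eigenvalue]; the two analytic ingredients are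
    [green_identity] and dominated convergence in [eigfun_weak]).

    The combinatorics of the atoms is controlled by [pos_far]: atoms whose
    digits differ at an order at least [m] are at distance at least
    [q m.+1 - 6 * q m].  Thus an interval of length [q m.+1 / 2] contains at most
    [4 ^ m] atoms, of mass at most 2 each, which makes the measure uniformly
    locally bounded with uniform density 0 ([gordon_unif], [gordon_inf_unif]).

    The number [p = q m.+1] is an almost period.  Adding it to an atom increases
    the digit of order [m] by 1, and the four available values -1, 0, 1, 2 are
    exactly what is needed to compare [mu] with [mu (. + p)] on [[-p, p]].  Since
    the heights are multiplicative, the values of [u / h] at corresponding atoms
    have the same contributions from the block of [4 ^ m] atoms around them, and
    the other atoms contribute only [exp (- p + O (q m))] ([strength_shift]).  As
    [q m / p] tends to 0, this gives the weak Gordon property for every weight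
    below 1 and the bound [1 <= C_mu] ([gordon_gap_le]).  Test functions have to
    be bounded here although their derivatives are controlled only almost
    everywhere; this is [lipschitz_ae_derive_le].

    Conversely no [p] does much better ([gordon_gap_lower]).  If [p] is at
    distance at least [exp (- p)] from all atoms, a tent at the atom 0 detects
    the difference of [mu] and its translate.  Otherwise [p] is nearly an atom
    [y]; if [y] is not one of the numbers [q m.+1], some atom [x] is translated
    by [y] to a point far from all atoms ([shift_witness]), and a tent at [x]
    does; if [y = q m.+1], a plateau around 0 detects the difference of the
    strengths at 0 and at [y], which is at least [exp (- y) / 3] because the
    tunnelling from 0 to [y] is weighted by [h 0 / h y], large against its
    counterpart from [y] to 0 ([strength_gap]).  Therefore [C_mu = 1]. *)

Set Implicit Arguments.
Unset Strict Implicit.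
Unset Printing Implicit Defensive.
Import Order.TTheory GRing.Theory Num.Theory.
Import numFieldNormedType.Exports.
Import ComplexField.Normc.
Local Open Scope classical_set_scope.
Local Open Scope ring_scope.

(** * Lipschitz functions and their almost everywhere derivatives *)

Section lipschitz_stieltjes.
Context {R : realType}.
Variables (f : R -> R) (k : R).
Hypothesis k0 : 0 <= k.
Hypothesis fk : forall x y, `|f x - f y| <= k * `|x - y|.

(** A Lipschitz function made nondecreasing by adding [k * x]; its
    Lebesgue-Stieltjes measure is absolutely continuous. *)
Definition lip_tilt (x : R) : R := f x + k * x.

Lemma lip_tilt_nd : nondecreasing lip_tilt.
Proof.
move=> x y xy; rewrite /lip_tilt.
have := fk x y; rewrite ler_norml distrC ger0_norm ?subr_ge0// => /andP[_].
lra.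
Qed.

Lemma lip_continuous : continuous f.
Proof.
have k1 : 0 < k + 1 by rewrite ltr_wpDl.
move=> x; apply/cvgrPdist_le => e e0; near=> y.
apply: (le_trans (fk x y)); apply: (@le_trans _ _ ((k + 1) * `|x - y|)).
  by apply: ler_wpM2r => //; rewrite lerDl.
rewrite mulrC -ler_pdivlMr//.
near: y; apply: cvgr_dist_le; first exact: cvg_id.
by rewrite divr_gt0.
Unshelve. all: by end_near. Qed.

Lemma lip_tilt_rc : right_continuous lip_tilt.
Proof.
apply: right_continuousW => x; rewrite /lip_tilt.
apply: cvgD; first exact: lip_continuous.
by apply: cvgM; [exact: cvg_cst|exact: cvg_id].
Qed.

HB.instance Definition _ :=
  isCumulative.Build R _ R lip_tilt lip_tilt_nd lip_tilt_rc.

Lemma lip_stieltjes_le (A : set (measurableTypeR R)) :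
  (lebesgue_stieltjes_measure lip_tilt A <=
   (2 * k + 1)%:E * lebesgue_measure A)%E.
Proof.
(* [2 * k] would do, but a positive factor can be divided by *)
have k1 : 0 < 2 * k + 1 by rewrite ltr_wpDl// mulr_ge0.
rewrite -lee_pdivrMl//; apply: le_ereal_inf_tmp => _ [B [mB AB] <-].
rewrite lee_pdivrMl// -nneseriesZl; last first.
  by move=> i _; exact: wlength_ge0.
apply: (@le_trans _ _ (\sum_(i <oo) (wlength lip_tilt (B i)))%E).
  by apply: ereal_inf_lbound; exists B.
apply: lee_nneseries => [i _ _|i _]; first exact: wlength_ge0.
have [[a b] _ <-] := mB i; rewrite [X in (X <= _)%E]wlength_itv [X in (_ * X)%E]wlength_itv/= lte_fin.
case: ifPn => ab; last by rewrite mule0.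
rewrite -!EFinB -EFinM lee_fin /lip_tilt.
have := fk b a; rewrite ler_norml gtr0_norm ?subr_gt0// => /andP[_].
lra.
Qed.

Lemma lip_stieltjes_itv (a b : R) : a <= b ->
  lebesgue_stieltjes_measure lip_tilt `]a, b] = (lip_tilt b - lip_tilt a)%:E.
Proof.
move=> ab; rewrite /lebesgue_stieltjes_measure /measure_extension/=.
rewrite measurable_mu_extE/=; last exact: is_ocitv.
by rewrite wlength_itv_bnd.
Qed.

(** Radon-Nikodym: the increments of the tilted function on [[a, b]] are the
    integrals of a density. *)
Lemma lip_density (a b : R) : a <= b -> exists h : R -> R,
  [/\ (forall x, 0 <= h x),
   (@lebesgue_measure R).-integrable setT (EFin \o h) &
   forall t, a <= t <= b ->
     (lip_tilt t - lip_tilt a)%:E = (\int[lebesgue_measure]_(x in `]a, t]) (h x)%:E)%E].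
Proof.
move=> ab; set nu := lebesgue_stieltjes_measure lip_tilt.
have mab : measurable (`]a, b]%classic : set (measurableTypeR R)) by [].
have nuab : (nu `]a, b]%classic < +oo)%E by rewrite /nu lip_stieltjes_itv ?ltry.
have dom : mfrestr mab nuab `<< (@lebesgue_measure R).
  apply/null_content_dominatesP => A mA A0.
  apply/eqP; rewrite -measure_le0.
  have le1 : (nu (A `&` `]a, b]) <= nu A)%E.
    by apply: le_measure; rewrite ?inE//; exact: measurableI.
  apply: (le_trans le1); apply: (le_trans (lip_stieltjes_le A)).
  by move: A0 => /= ->; rewrite mule0.
have [h [h0 hfin inth nuE]] := radon_nikodym_sigma_finite dom.
exists (fine \o h); split => [x||t /andP[at_ tb]]; first exact: fine_ge0.
  by apply: eq_integrable inth => // x _ /=; rewrite fineK.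
have -> : (\int[lebesgue_measure]_(x in `]a, t]) ((fine \o h) x)%:E)%E =
    (\int[lebesgue_measure]_(x in `]a, t]) h x)%E.
  by apply: eq_integral => x _ /=; rewrite fineK.
rewrite -nuE//.
have tE : `]a, t]%classic `&` `]a, b]%classic = `]a, t]%classic :> set R.
  apply/seteqP; split => x /=; rewrite !in_itv/=; first by case.
  by move=> /andP[-> xt]; rewrite xt (le_trans xt tb).
rewrite [RHS](_ : _ = nu (`]a, t]%classic `&` `]a, b]%classic))// tE.
exact/esym/lip_stieltjes_itv.
Qed.

(** A bound for the derivative that holds almost everywhere is a Lipschitz
    constant.  By the Lebesgue differentiation theorem the density above is
    almost everywhere the derivative [f' + k], so that in particular [f] is
    differentiable almost everywhere. *)
Lemma lipschitz_ae_derive_le (c : R) : 0 <= c ->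
  {ae (@lebesgue_measure R), forall x, `|derive1 f x| <= c} ->
  forall x y, `|f x - f y| <= c * `|x - y|.
Proof.
move=> c0 fc.
suff main a b : a < b -> `|f b - f a| <= c * (b - a).
  move=> x y; have [xy|xy|->] := ltgtP x y.
  - by rewrite distrC (distrC x) (gtr0_norm (_ : 0 < y - x)) ?subr_gt0// main.
  - by rewrite (gtr0_norm (_ : 0 < x - y)) ?subr_gt0// main.
  - by rewrite !subrr normr0 mulr0.
move=> ab; have [h [h0 inth hE]] := lip_density (ltW ab).
have loch : locally_integrable setT h by apply: open_integrable_locally => //; exact: openT.
have intS (A : set R) : measurable A -> (@lebesgue_measure R).-integrable A (EFin \o h).
  by move=> mA; apply: integrableS inth.
have FTC := FTC1 (a := BRight a) (fun y => intS _ (measurable_itv _)) loch.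
have hc : {ae (@lebesgue_measure R), forall x, `]a, b]%classic x -> `|h x - k| <= c}.
  have ab0 : {ae (@lebesgue_measure R), forall x, x != b}.
    exists [set b]; split => //; first exact: lebesgue_measure_set1.
    by move=> x /= /negP; rewrite negbK => /eqP.
  apply: (filterS3 _ _ FTC fc ab0).
    exact: (ae_filter_ringOfSetsType (@lebesgue_measure R)).
  move=> x FTCx fcx xb' /=; rewrite in_itv/= => /andP[ax].
  rewrite le_eqVlt (negbTE xb')/= => xb.
  have /FTCx : (BRight a < BRight x)%O by rewrite bnd_simp.
  set F := (fun x0 => _) => -[dF F'].
  have feq : \forall z \near x, F z - k * z + lip_tilt a = f z.
    near=> z.
    have zab : a <= z <= b.
      by apply/andP; split; apply: ltW; near: z; [exact: lt_nbhsr|exact: lt_nbhsl].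
    have := hE _ zab; rewrite /=.
    rewrite -[X in (_ = X)%E]fineK; last by apply: integrable_fin_num => //; exact: intS.
    move=> [] Fz; have {}Fz : lip_tilt z - lip_tilt a = F z := Fz.
    by rewrite -Fz /lip_tilt; lra.
  have -> : h x - k = derive1 f x.
    clear FTCx; move: F' dF feq; move: F => F F' /derivableP dF feq.
    rewrite derive1E -(near_eq_derive _ feq) -F' derive1E.
    apply/esym/derive_val.
    have -> : (fun z => F z - k * z + lip_tilt a) =
              F - k \*: (@idfun R) + cst (lip_tilt a) by [].
    by apply: is_derive_eq; rewrite addr0 scaler1.
  by [].
have hab := hE b (_ : a <= b <= b); rewrite lexx ltW// in hab.
have {}hab := hab isT.
have mh : measurable_fun (`]a, b]%classic : set (measurableTypeR R)) (fun x => (h x)%:E).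
  by have /measurable_int := intS _ (measurable_itv `]a, b]).
have cstE r : (\int[lebesgue_measure]_(x in `]a, b]) (cst r%:E x) = (r * (b - a))%:E)%E.
  by rewrite integral_cst//= lebesgue_measure_itv/= lte_fin ab -EFinB EFinM.
have ub : (\int[lebesgue_measure]_(x in `]a, b]) (h x)%:E <= ((k + c) * (b - a))%:E)%E.
  rewrite -cstE; apply: ae_ge0_le_integral => //.
  - by move=> x _; rewrite lee_fin.
  - by move=> x _; rewrite lee_fin addr_ge0.
  - apply: (@filterS _ _ (ae_filter_ringOfSetsType (@lebesgue_measure R)) _ _ _ hc) => x + abx => /(_ abx).
    by rewrite lee_fin ler_norml => /andP[_]; rewrite lerBlDl.
have lb : ((Num.max (k - c) 0 * (b - a))%:E <=
    \int[lebesgue_measure]_(x in `]a, b]) (h x)%:E)%E.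
  rewrite -cstE; apply: ae_ge0_le_integral => //.
  - by move=> x _; rewrite lee_fin le_max lexx orbT.
  - by move=> x _; rewrite lee_fin.
  - apply: (@filterS _ _ (ae_filter_ringOfSetsType (@lebesgue_measure R)) _ _ _ hc) => x + abx => /(_ abx).
    by rewrite lee_fin ge_max h0 andbT ler_norml => /andP[+ _]; lra.
move: ub lb; rewrite -hab !lee_fin /lip_tilt => ub lb.
have : (k - c) * (b - a) <= Num.max (k - c) 0 * (b - a).
  by rewrite ler_wpM2r ?subr_ge0 1?(ltW ab)// le_max lexx.
rewrite ler_norml; lra.
Unshelve. all: by end_near. Qed.

End lipschitz_stieltjes.

(** * The atoms: positions and heights *)

Section atoms.
Context {R : realType}.

(** The scales [q m]; the digit of order [k] of an atom has the weight [q k.+1]. *)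
Fixpoint scale (m : nat) : R :=
  if m is m'.+1 then (21 + m'%:R) * scale m' else 4.

Local Notation q := scale.

Lemma scaleS m : q m.+1 = (21 + m%:R) * q m.
Proof. by []. Qed.

Lemma scale0 : q 0 = 4. Proof. by []. Qed.

Arguments scale : simpl never.

Lemma scale_ge4 m : 4 <= q m.
Proof.
elim: m => [|m IH]; first by [].
have := ler0n R m; rewrite scaleS; nra.
Qed.

Lemma scale_gt0 m : 0 < q m.
Proof. by have := scale_ge4 m; lra. Qed.

Lemma scale_leS m : 21 * q m <= q m.+1.
Proof. by have := ler0n R m; have := scale_ge4 m; rewrite scaleS; nra. Qed.

Lemma scale_mono m n : (m <= n)%N -> q m <= q n.
Proof.
elim: n => [|n IH]; first by rewrite leqn0 => /eqP ->.
rewrite leq_eqVlt => /predU1P[-> //|]; rewrite ltnS => /IH.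
have := scale_leS n; have := scale_ge4 n; lra.
Qed.

Lemma scale_gap_mono (c : R) m n : c <= 21 -> (m <= n)%N ->
  q m.+1 - c * q m <= q n.+1 - c * q n.
Proof.
move=> c21 mn; rewrite !scaleS -!mulrBl.
have := scale_mono mn; have := scale_ge4 m.
have : m%:R <= n%:R :> R by rewrite ler_nat.
have := ler0n R m; move: (m%:R) (n%:R) => a b; nra.
Qed.

Lemma scale_ge_expn m : 4 * 21 ^+ m <= q m.
Proof.
elim: m => [|m IH]; first by rewrite expr0 mulr1.
by have := scale_leS m; rewrite exprS; lra.
Qed.

Lemma scale_ge_nat m : m%:R <= q m.
Proof.
elim: m => [|m IH]; first by [].
have := scale_leS m; have := scale_ge4 m; rewrite -addn1 natrD; lra.
Qed.

(** The base-4 digit of order [k] of [n]. *)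
Definition digit (n k : nat) : nat := (n %/ 4 ^ k %% 4)%N.

(** Digits stand for 0, 1, 2, -1, in this order, so that the cyclic successor of
    a digit other than 2 has its value increased by 1. *)
Definition sdigit (c : nat) : R := if c == 3 then -1 else c%:R.

(** The factor by which a nonzero digit of order [k] reduces the height. *)
Definition weight (k : nat) : R := expR (- (8 * q k)).

(** Position of the [n]-th atom.  The sum stops at [n] since [n < 4 ^ n]. *)
Definition pos (n : nat) : R := \sum_(k < n) sdigit (digit n k) * q k.+1.
(** Height of the [n]-th atom, that is, the weight of its exponential in the
    eigenfunction. *)
Definition height (n : nat) : R :=
  \prod_(k < n) (if digit n k == 0 then 1 else weight k).

Lemma digit_high n k : (n < 4 ^ k)%N -> digit n k = 0.
Proof. by move=> nk; rewrite /digit divn_small. Qed.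

Lemma big_ord_trunc T idx (op : Monoid.law idx) (F : nat -> T) M N :
  (M <= N)%N -> (forall k, (M <= k)%N -> F k = idx) ->
  \big[op/idx]_(k < N) F k = \big[op/idx]_(k < M) F k.
Proof.
move=> MN F0; rewrite -!(big_mkord xpredT) (big_cat_nat (n := M))//=.
rewrite [X in op _ X]big1_seq ?Monoid.mulm1// => k /=.
by rewrite mem_index_iota => /andP[/F0].
Qed.

Lemma posE n M : (n < 4 ^ M)%N ->
  pos n = \sum_(k < M) sdigit (digit n k) * q k.+1.
Proof.
pose F k := sdigit (digit n k) * q k.+1.
have F0 K : (n < 4 ^ K)%N -> forall k, (K <= k)%N -> F k = 0.
  move=> nK k Kk; rewrite /F digit_high ?mul0r//.
  by rewrite (leq_trans nK)// leq_pexp2l.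
move=> nM; have n4 : (n < 4 ^ n)%N by rewrite ltn_expl.
have [MN|NM] := leqP M n.
  by rewrite /pos (big_ord_trunc _ MN (F0 _ nM)).
by rewrite [RHS](big_ord_trunc _ (ltnW NM) (F0 _ n4)).
Qed.

Lemma heightE n M : (n < 4 ^ M)%N ->
  height n = \prod_(k < M) (if digit n k == 0 then 1 else weight k).
Proof.
pose F k := if digit n k == 0 then 1 else weight k.
have F0 K : (n < 4 ^ K)%N -> forall k, (K <= k)%N -> F k = 1.
  move=> nK k Kk; rewrite /F digit_high//.
  by rewrite (leq_trans nK)// leq_pexp2l.
move=> nM; have n4 : (n < 4 ^ n)%N by rewrite ltn_expl.
have [MN|NM] := leqP M n.
  by rewrite /height (big_ord_trunc _ MN (F0 _ nM)).
by rewrite [RHS](big_ord_trunc _ (ltnW NM) (F0 _ n4)).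
Qed.

Lemma digit_block m b c k : (k < m)%N -> digit (b + c * 4 ^ m) k = digit b k.
Proof.
move=> km; rewrite /digit -(subnK km) expnD expnS.
rewrite (_ : c * (4 ^ (m - k.+1) * (4 * 4 ^ k)) = (c * 4 ^ (m - k.+1) * 4) * 4 ^ k)%N; last lia.
by rewrite addnC divnMDl ?expn_gt0// modnMDl.
Qed.

Lemma digit_block_top m b c : (b < 4 ^ m)%N -> (c < 4)%N ->
  digit (b + c * 4 ^ m) m = c.
Proof.
move=> bm c4; rewrite /digit addnC divnMDl ?expn_gt0//.
by rewrite divn_small// addn0 modn_small.
Qed.

Lemma ltn_block m b c : (b < 4 ^ m)%N -> (c < 4)%N -> (b + c * 4 ^ m < 4 ^ m.+1)%N.
Proof. by move=> bm c4; rewrite expnS; nia. Qed.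

Lemma pos_block m b c : (b < 4 ^ m)%N -> (c < 4)%N ->
  pos (b + c * 4 ^ m) = pos b + sdigit c * q m.+1.
Proof.
move=> bm c4; rewrite (posE (ltn_block bm c4)) (posE bm) big_ord_recr/=.
rewrite digit_block_top//; congr (_ + _); apply: eq_bigr => k _.
by rewrite digit_block.
Qed.

Lemma height_block m b c : (b < 4 ^ m)%N -> (c < 4)%N ->
  height (b + c * 4 ^ m) = height b * (if c == 0 then 1 else weight m).
Proof.
move=> bm c4; rewrite (heightE (ltn_block bm c4)) (heightE bm) big_ord_recr/=.
rewrite digit_block_top//; congr (_ * _); apply: eq_bigr => k _.
by rewrite digit_block.
Qed.

Lemma block_split m n : (n < 4 ^ m.+1)%N ->
  exists b c, [/\ (b < 4 ^ m)%N, (c < 4)%N & n = (b + c * 4 ^ m)%N].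
Proof.
move=> nm; exists (n %% 4 ^ m)%N, (n %/ 4 ^ m)%N; split.
- by rewrite ltn_mod expn_gt0.
- by rewrite ltn_divLR ?expn_gt0// -expnS.
- by rewrite addnC -divn_eq.
Qed.

Lemma sdigit_bound c : (c < 4)%N -> -1 <= sdigit c <= 2.
Proof. by case: c => [|[|[|[|]]]]// _; rewrite /sdigit/=; apply/andP; split; lra. Qed.

Lemma sdigit_neq c d : (c < 4)%N -> (d < 4)%N -> c != d ->
  1 <= `|sdigit c - sdigit d|.
Proof.
case: c => [|[|[|[|]]]]// _; case: d => [|[|[|[|]]]]// _ _;
  rewrite /sdigit/= ler_normr; apply/orP; (left; lra) || (right; lra).
Qed.

Lemma pos_bound m n : (n < 4 ^ m)%N -> `|pos n| <= 3 * q m.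
Proof.
elim: m n => [|m IH] n.
  rewrite expn0 ltnS leqn0 => /eqP ->; rewrite /pos big_ord0 normr0.
  by rewrite mulr_ge0// ltW// scale_gt0.
move=> /block_split[b [c [bm c4 ->]]]; rewrite pos_block//.
have := IH _ bm; have /andP[] := sdigit_bound c4.
have := scale_leS m; have := scale_gt0 m.
move: (pos b) (sdigit c) (q m.+1) (q m) => x e Q r.
by rewrite !ler_norml => r0 rQ e1 e2 /andP[x1 x2]; apply/andP; split; nra.
Qed.

(** Positions whose digits differ at an order at least [m] are far apart; the
    highest order where they differ decides. *)
Lemma pos_far m n n' : (n %/ 4 ^ m)%N != (n' %/ 4 ^ m)%N ->
  q m.+1 - 6 * q m <= `|pos n - pos n'|.
Proof.
move=> nn'.
have [M] : exists M, (n < 4 ^ M)%N && (n' < 4 ^ M)%N.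
  exists (n + n')%N; apply/andP; split;
  by rewrite (leq_trans (ltn_expl _ (isT : (1 < 4)%N)))// leq_pexp2l//; lia.
elim: M n n' nn' => [|M IH] n n' nn' /andP[].
  rewrite expn0 !ltnS !leqn0 => /eqP n0 /eqP n'0; by rewrite n0 n'0 eqxx in nn'.
move=> /block_split[b [c [bM c4 nE]]] /block_split[b' [c' [bM' c4' nE']]].
have [cc'|cc'] := eqVneq c c'.
  subst c'; have [Mm|mM] := ltnP M m.
    exfalso; move: nn'; rewrite nE nE' !divn_small ?eqxx//;
    by rewrite (leq_trans (ltn_block _ _))// leq_pexp2l.
  have bb' : (b %/ 4 ^ m)%N != (b' %/ 4 ^ m)%N.
    move: nn'; rewrite nE nE' -(subnK (mM : m <= M)%N) expnD mulnA.
    by rewrite !(addnC _ (_ * _)%N) !divnMDl ?expn_gt0// eqn_add2l.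
  have := IH _ _ bb'; rewrite bM bM' => /(_ isT).
  by rewrite nE nE' !pos_block// opprD addrACA subrr addr0.
have mM : (m <= M)%N.
  rewrite leqNgt; apply: contra nn' => Mm; rewrite nE nE' !divn_small//;
  by rewrite (leq_trans (ltn_block _ _))// leq_pexp2l.
have := pos_bound bM; have := pos_bound bM'; have := sdigit_neq c4 c4' cc'.
rewrite nE nE' !pos_block//; have := scale_gt0 M.+1.
have := @scale_gap_mono 6 _ _ (ltac:(lra)) mM.
move: (pos b) (pos b') (sdigit c) (sdigit c') => x y e d.
move=> gap Q0 ed xb yb.
have -> : x + e * q M.+1 - (y + d * q M.+1) = (e - d) * q M.+1 - (y - x) by lra.
apply: le_trans (lerB_dist _ _); rewrite normrM (gtr0_norm Q0).
have := ler_normB y x; nra.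
Qed.

Lemma pos_high m n : (4 ^ m <= n)%N -> q m.+1 - 6 * q m <= `|pos n|.
Proof.
move=> mn; have -> : pos n = pos n - pos 0 by rewrite /pos big_ord0 subr0.
by apply: pos_far; rewrite div0n -lt0n divn_gt0// expn_gt0.
Qed.

Lemma pos_range m n : (n < 4 ^ m.+1)%N ->
  - q m.+1 - 3 * q m <= pos n <= 2 * q m.+1 + 3 * q m.
Proof.
move=> /block_split[b [c [bm c4 ->]]]; rewrite pos_block//.
have := pos_bound bm; have /andP[] := sdigit_bound c4; have := scale_gt0 m.+1.
move: (pos b) (sdigit c) => x e Q0 e1 e2; rewrite ler_norml => /andP[x1 x2].
by apply/andP; split; nra.
Qed.

(** No atom lies where the digit of order [k] would have to be 3 or 4. *)
Lemma pos_avoid_above k n (s : R) :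
  3 * q k.+1 - 3 * q k <= s <= 4 * q k.+1 + 3 * q k -> 1 <= `|pos n - s|.
Proof.
move=> /andP[s1 s2]; have Qk := scale_leS k; have Q4 := scale_ge4 k.
have [nk|kn] := ltnP n (4 ^ k.+1)%N.
  have /andP[_ y2] := pos_range nk.
  by rewrite distrC ler_normr; apply/orP; left; lra.
have := pos_high kn; have := scale_leS k.+1; rewrite distrC.
have s0 : `|s| <= 4 * q k.+1 + 3 * q k by rewrite ger0_norm//; lra.
have := lerB_dist (pos n) s; rewrite distrC; lra.
Qed.

(** No atom lies where the digit of order [k] would have to be -2. *)
Lemma pos_avoid_below k n (s : R) :
  - 2 * q k.+1 - 3 * q k <= s <= - 2 * q k.+1 + 3 * q k -> 1 <= `|pos n - s|.
Proof.
move=> /andP[s1 s2]; have Qk := scale_leS k; have Q4 := scale_ge4 k.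
have [nk|kn] := ltnP n (4 ^ k.+1)%N.
  have /andP[y1 _] := pos_range nk.
  by rewrite ler_normr; apply/orP; left; lra.
have := pos_high kn; have := scale_leS k.+1.
have s0 : `|s| <= 4 * q k.+1 + 3 * q k by rewrite ler0_norm//; lra.
have := lerB_dist (pos n) s; lra.
Qed.

Lemma pos0 : pos 0 = 0. Proof. by rewrite /pos big_ord0. Qed.

Lemma height0 : height 0 = 1. Proof. by rewrite /height big_ord0. Qed.

Lemma pos_pure k c : (c < 4)%N -> pos (c * 4 ^ k) = sdigit c * q k.+1.
Proof.
by move=> c4; rewrite -[(c * _)%N]add0n pos_block ?expn_gt0// pos0 add0r.
Qed.

Lemma height_pure k c : (c < 4)%N -> c != 0 -> height (c * 4 ^ k) = weight k.
Proof.
move=> c4 /negbTE c0.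
by rewrite -[(c * _)%N]add0n height_block ?expn_gt0// height0 mul1r c0.
Qed.

Lemma top_digit n : (0 < n)%N -> exists m b c,
  [/\ (b < 4 ^ m)%N, (0 < c < 4)%N & n = (b + c * 4 ^ m)%N].
Proof.
move=> n0; have : (n < 4 ^ n)%N by rewrite ltn_expl.
move: {2}n => M; elim: M => [|M IH]; first by rewrite expn0 ltnS leqNgt n0.
move=> /block_split[b [c [bM c4 nE]]].
have [c0|c0] := posnP c; first by apply: IH; rewrite nE c0 addn0.
by exists M, b, c; rewrite c0.
Qed.

(** A positive position [pos n], unless it is a pure scale [q m.+1], is not an
    almost period of the atoms: some atom, closer to the origin than [pos n],
    is translated by it to a point at distance at least 1 from all atoms.  The
    atom is chosen so that one digit of the sum leaves the range from -1 to 2. *)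
Lemma shift_witness n : 0 < pos n -> (exists m, n = 4 ^ m)%N \/
  exists i, [/\ `|pos i| + 2 <= pos n, expR (- pos n + 2) <= height i &
    forall n', 1 <= `|pos n' - (pos i + pos n)|].
Proof.
have [->|n0] := posnP n; first by rewrite pos0 ltxx.
have [m [b [c [bm /andP[c0 c4] ->]]]] := top_digit n0.
rewrite pos_block//; have bB := pos_bound bm.
have Qm := scale_leS m; have Qm4 := scale_ge4 m.
case: c c0 c4 => // -[|[|[|]]]// _ _; rewrite /sdigit/=; last first.
- by move: bB; rewrite ler_norml => /andP[b1 b2]; lra.
- move=> _; right; exists (1 * 4 ^ m)%N.
  rewrite pos_pure// height_pure// /sdigit/= mul1r.
  move: bB; rewrite ler_norml => /andP[b1 b2].
  rewrite gtr0_norm; last lra.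
  split; [lra|by rewrite ler_expR; lra|move=> n'].
  by apply: (@pos_avoid_above m); apply/andP; split; lra.
rewrite !mul1r; have [->|b0] := posnP b.
  by move=> _; left; exists m; rewrite add0n mul1n.
have [k [d [e [dk /andP[e0 e4] bE]]]] := top_digit b0.
have km : (k < m)%N.
  rewrite ltnNge; apply/negP => mk; have : (4 ^ m <= 4 ^ k)%N by rewrite leq_pexp2l.
  by move: bm; rewrite bE; nia.
have dB := pos_bound dk; have Qk := scale_leS k; have Qk4 := scale_ge4 k.
have Qkm := scale_mono km.
(* [pos b + x] is away from all atoms, for a suitable [x] of size [q k.+1] *)
have [i [xi hi bx]] : exists i, [/\ `|pos i| <= 2 * q k.+1, height i = weight k &
    forall n', 1 <= `|pos n' - (pos i + pos b)|].
  rewrite bE pos_block//; move: dB; rewrite ler_norml => /andP[d1 d2].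
  case: e e0 e4 {bE} => // -[|[|[|]]]// _ _; rewrite /sdigit/=.
  - exists (2 * 4 ^ k)%N; rewrite pos_pure// height_pure// /sdigit/=.
    rewrite gtr0_norm; last lra.
    by split => // n'; apply: (@pos_avoid_above k); apply/andP; split; lra.
  - exists (2 * 4 ^ k)%N; rewrite pos_pure// height_pure// /sdigit/=.
    rewrite gtr0_norm; last lra.
    by split => // n'; apply: (@pos_avoid_above k); apply/andP; split; lra.
  - exists (3 * 4 ^ k)%N; rewrite pos_pure// height_pure// /sdigit/=.
    rewrite ltr0_norm; last lra.
    split; [lra|by []|move=> n'].
    by apply: (@pos_avoid_below k); apply/andP; split; lra.
move=> _; right; exists i.
move: bB; rewrite ler_norml => /andP[b1 b2]; split.
- lra.
- by rewrite hi ler_expR; lra.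
move=> n'; have [/eqP nn'|nn'] := boolP (n' %/ 4 ^ m == 1)%N.
  rewrite (divn_eq n' (4 ^ m)) nn' addnC pos_block ?ltn_mod ?expn_gt0//.
  rewrite /sdigit/= mul1r.
  have := bx (n' %% 4 ^ m)%N.
  by congr (1 <= `|_|); lra.
have := @pos_far m n' (1 * 4 ^ m)%N; rewrite mulnK ?expn_gt0// => /(_ nn').
rewrite pos_pure// /sdigit/= mul1r => far.
have := lerB_dist (pos n' - q m.+1) (pos i + pos b).
have -> : pos n' - q m.+1 - (pos i + pos b) = pos n' - (pos i + (pos b + q m.+1)) by lra.
have := ler_normD (pos i) (pos b).
have : `|pos b| <= 3 * q m by rewrite ler_norml; apply/andP; split; lra.
lra.
Qed.

Lemma pos_far_nat m n : (4 ^ m <= n)%N -> m%:R <= `|pos n|.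
Proof.
move=> /pos_high; have := scale_leS m; have := scale_gt0 m.
by have := scale_ge_nat m; lra.
Qed.

Lemma height_gt0 n : 0 < height n.
Proof. by apply: prodr_gt0 => k _; case: ifP => // _; exact: expR_gt0. Qed.

Lemma height_ge_block m n : (n < 4 ^ m)%N -> expR (- q m) <= height n.
Proof.
elim: m n => [|m IH] n.
  rewrite expn0 ltnS leqn0 => /eqP ->; rewrite height0 -expR0 ler_expR.
  by have := scale_gt0 0; lra.
move=> /block_split[b [c [bm c4 ->]]]; rewrite height_block//.
apply: (@le_trans _ _ (expR (- q m) * expR (- (8 * q m)))).
  by rewrite -expRD ler_expR; have := scale_leS m; have := scale_gt0 m; lra.
apply: ler_pM; rewrite ?expR_ge0//; first exact: IH.
case: ifP => // _; rewrite -[leRHS]expR0 ler_expR.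
by have := scale_gt0 m; lra.
Qed.

Lemma sum_block (V : nmodType) (F : nat -> V) m :
  \sum_(n < 4 ^ m.+1) F n =
  \sum_(b < 4 ^ m) (F b + F (b + 1 * 4 ^ m)%N + F (b + 2 * 4 ^ m)%N + F (b + 3 * 4 ^ m)%N).
Proof.
have -> : (4 ^ m.+1 = 4 ^ m + (4 ^ m + (4 ^ m + 4 ^ m)))%N by rewrite expnS; lia.
rewrite !big_split_ord/= !big_split/= -!addrA.
congr (_ + (_ + (_ + _))); apply: eq_bigr => i _; congr F; lia.
Qed.

(** The sum over a block is multiplied by [1 + 3 * weight m] at each order; the
    term [(q m)^-1] makes room for these factors. *)
Lemma sum_height_block m : \sum_(n < 4 ^ m) height n <= 2 - (q m)^-1.
Proof.
elim: m => [|m IH].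
  rewrite expn0 big_ord1 height0 scale0; lra.
rewrite sum_block.
under eq_bigr => b _.
  have -> : height b + height (b + 1 * 4 ^ m) + height (b + 2 * 4 ^ m) +
      height (b + 3 * 4 ^ m) = height b * (1 + 3 * weight m).
    by rewrite !height_block//=; ring.
  over.
rewrite -mulr_suml.
have q0 := scale_gt0 m; have Q0 := scale_gt0 m.+1.
have wm : weight m <= (8 * q m)^-1.
  rewrite /weight expRN lef_pV2 ?posrE ?expR_gt0//; last lra.
  by have := expR_ge1Dx (8 * q m); lra.
have wm0 : 0 < weight m by exact: expR_gt0.
have iq : (8 * q m)^-1 = (q m)^-1 / 8 by rewrite invfM mulrC.
have iq0 : 0 < (q m)^-1 by rewrite invr_gt0.
have iQ : (q m.+1)^-1 <= (q m)^-1 / 21.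
  rewrite -invfM lef_pV2 ?posrE//; last lra.
  by have := scale_leS m; lra.
have S0 : 0 <= \sum_(n < 4 ^ m) height n by apply: sumr_ge0 => n _; exact/ltW/height_gt0.
move: (\sum_(n < _) _) IH S0 => S IH S0.
rewrite iq in wm; nra.
Qed.

Lemma sum_height N : \sum_(n < N) height n <= 2.
Proof.
apply: (@le_trans _ _ (\sum_(n < 4 ^ N) height n)).
  rewrite (big_ord_widen_cond (4 ^ N)%N predT height) ?(ltnW (ltn_expl _ _))//=.
  rewrite big_mkcond/=; apply: ler_sum => n _; case: ifP => // _.
  exact/ltW/height_gt0.
apply: le_trans (sum_height_block N) _.
by rewrite gerBl invr_ge0 ltW// scale_gt0.
Qed.

(** * The eigenfunction and the strengths of the atoms *)

Definition bump (n : nat) (x : R) : R := height n * expR (- `|x - pos n|).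

Definition bump_sum (N : nat) (x : R) : R := \sum_(n < N) bump n x.

(** The eigenfunction: the sum of all bumps. *)
Definition eigfun (x : R) : R := limn (bump_sum ^~ x).

Lemma bump_ge0 n x : 0 <= bump n x.
Proof. by rewrite mulr_ge0 ?expR_ge0// ltW// height_gt0. Qed.

Lemma bump_le n x : bump n x <= height n.
Proof.
by rewrite /bump -[leRHS]mulr1 ler_wpM2l ?(ltW (height_gt0 n))//.
Qed.

Lemma bump_sum_ge0 N x : 0 <= bump_sum N x.
Proof. by apply: sumr_ge0 => n _; exact: bump_ge0. Qed.

Lemma bump_sum_le2 N x : bump_sum N x <= 2.
Proof. by apply: le_trans (sum_height N); apply: ler_sum => n _; exact: bump_le. Qed.

Lemma bump_sum_nd x : nondecreasing_seq (bump_sum ^~ x).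
Proof.
apply/nondecreasing_seqP => n; rewrite /bump_sum big_ord_recr/= lerDl.
exact: bump_ge0.
Qed.

Lemma bump_sum_cvg x : bump_sum ^~ x @ \oo --> eigfun x.
Proof.
apply: nondecreasing_is_cvgn; first exact: bump_sum_nd.
by exists 2 => _ [N _ <-]; exact: bump_sum_le2.
Qed.

Lemma eigfun_ge_sum N x : bump_sum N x <= eigfun x.
Proof. by apply: nondecreasing_cvgn_le; [exact: bump_sum_nd|exact: bump_sum_cvg]. Qed.

Lemma eigfun_le_ub (c : R) x : (\forall N \near \oo, bump_sum N x <= c) -> eigfun x <= c.
Proof. by move=> h; apply: limr_le => //; exact: bump_sum_cvg. Qed.

Lemma eigfun_le2 x : eigfun x <= 2.
Proof. by apply: eigfun_le_ub; apply: nearW => N; exact: bump_sum_le2. Qed.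

Lemma eigfun_gt0 x : 0 < eigfun x.
Proof.
apply: lt_le_trans (eigfun_ge_sum 1 x).
by rewrite /bump_sum big_ord1 mulr_gt0 ?height_gt0 ?expR_gt0.
Qed.

Lemma eigfun_ge_partial (P : pred nat) N x :
  \sum_(k < N | P k) bump k x <= eigfun x.
Proof.
apply: le_trans (eigfun_ge_sum N x); rewrite /bump_sum big_mkcond/=.
by apply: ler_sum => k _; case: ifP => // _; exact: bump_ge0.
Qed.

(** The heights have sum at most 2, so the atoms outside a finite set contribute
    at most twice the largest of their exponential factors. *)
Lemma eigfun_le_partial (P : pred nat) N (D x : R) :
  (forall k, ~~ (P k && (k < N)%N) -> expR (- `|x - pos k|) <= D) ->
  eigfun x <= \sum_(k < N | P k) bump k x + 2 * D.
Proof.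
move=> PD; apply: eigfun_le_ub; near=> M.
have NM : (N <= M)%N by near: M; exact: nbhs_infty_ge.
have D0 : 0 <= D by apply: le_trans (PD N _); rewrite ?expR_ge0// ltnn andbF.
rewrite /bump_sum (bigID (fun k : 'I_M => P k && (k < N)%N))/= lerD//.
  by rewrite (big_ord_widen_cond M P (bump ^~ x)).
apply: (@le_trans _ _ (\sum_(k < M | ~~ (P k && (k < N)%N)) height k * D)).
  by apply: ler_sum => k Pk; rewrite ler_wpM2l ?PD// ltW// height_gt0.
rewrite -mulr_suml ler_wpM2r//; apply: le_trans (sum_height M).
rewrite big_mkcond/=; apply: ler_sum => k _; case: ifP => // _.
exact/ltW/height_gt0.
Unshelve. all: by end_near. Qed.

Lemma expRN_lip (s t : R) : 0 <= s -> 0 <= t -> `|expR (- s) - expR (- t)| <= `|s - t|.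
Proof.
wlog st : s t / s <= t.
  move=> H s0 t0; have [|ts] := leP s t; first by move=> /H; apply.
  by rewrite distrC (distrC s); apply: H => //; exact: ltW.
move=> s0 t0; rewrite ger0_norm ?subr_ge0 ?ler_expR ?lerN2//.
rewrite distrC (ger0_norm (_ : 0 <= t - s)) ?subr_ge0//.
have -> : expR (- t) = expR (- s) * expR (- (t - s)) by rewrite -expRD; congr expR; lra.
have := expR_ge1Dx (- (t - s)); have : expR (- s) <= 1 by rewrite -[leRHS]expR0 ler_expR; lra.
have := expR_gt0 (- s); have := expR_gt0 (- (t - s)).
move: (expR (- s)) (expR _) => a b; nra.
Qed.

Lemma bump_lip n x y : `|bump n x - bump n y| <= height n * `|x - y|.
Proof.
rewrite /bump -mulrBr normrM (gtr0_norm (height_gt0 _)) ler_wpM2l//.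
  exact/ltW/height_gt0.
apply: le_trans (expRN_lip _ _) _ => //.
apply: le_trans (ler_dist_dist _ _) _.
by rewrite opprB addrA subrK.
Qed.

Lemma eigfun_lip x y : `|eigfun x - eigfun y| <= 2 * `|x - y|.
Proof.
have cv : (fun N => `|bump_sum N x - bump_sum N y|) @ \oo --> `|eigfun x - eigfun y|.
  by apply: cvg_norm; apply: cvgB; exact: bump_sum_cvg.
rewrite -(cvg_lim _ cv)//; apply: limr_le; first by apply/cvg_ex; exists `|eigfun x - eigfun y|.
apply: nearW => N; rewrite /bump_sum -sumrB.
apply: le_trans (ler_norm_sum _ _ _) _.
apply: (@le_trans _ _ (\sum_(n < N) height n * `|x - y|)).
  by apply: ler_sum => n _; exact: bump_lip.
by rewrite -mulr_suml ler_wpM2r// sum_height.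
Qed.

Lemma eigfun_continuous : continuous eigfun.
Proof.
move=> x; apply/cvgrPdist_le => e e0; near=> y.
apply: (le_trans (eigfun_lip x y)).
rewrite mulrC -ler_pdivlMr//; near: y; apply: cvgr_dist_le; first exact: cvg_id.
by rewrite divr_gt0.
Unshelve. all: by end_near. Qed.

(** Value of the eigenfunction at an atom, relative to the height of the atom. *)
Definition ratio n : R := eigfun (pos n) / height n.

(** Mass of the [n]-th atom of the measure, that is,
    [- 2 * height n / eigfun (pos n)]. *)
Definition strength n : R := - 2 / ratio n.

Lemma ratio_ge1 n : 1 <= ratio n.
Proof.
rewrite /ratio ler_pdivlMr ?height_gt0// mul1r.
apply: le_trans (eigfun_ge_sum n.+1 _).
rewrite /bump_sum big_ord_recr/= {2}/bump subrr normr0 oppr0 expR0 mulr1.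
by rewrite lerDr bump_sum_ge0.
Qed.

Lemma ratio_gt0 n : 0 < ratio n.
Proof. by apply: lt_le_trans (ratio_ge1 n). Qed.

Lemma strengthE n : strength n = - 2 * height n / eigfun (pos n).
Proof. by rewrite /strength /ratio invfM invrK; ring. Qed.

Lemma strength_eigfun n : strength n * eigfun (pos n) = - 2 * height n.
Proof. by rewrite strengthE divfK// gt_eqF// eigfun_gt0. Qed.

Lemma strength_norm n : `|strength n| = 2 / ratio n.
Proof.
by rewrite /strength mulNr normrN gtr0_norm// divr_gt0// ratio_gt0.
Qed.

Lemma strength_le2 n : `|strength n| <= 2.
Proof.
by rewrite strength_norm ler_pdivrMr ?ratio_gt0//; have := ratio_ge1 n; lra.
Qed.

Lemma strength_ge_height n : height n <= `|strength n|.
Proof.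
rewrite strength_norm /ratio invf_div mulrA ler_pdivlMr ?eigfun_gt0// mulrC.
by rewrite ler_wpM2r ?eigfun_le2// ltW// height_gt0.
Qed.

Lemma strength_dist n n' : `|strength n - strength n'| <= 2 * `|ratio n - ratio n'|.
Proof.
have g0 := ratio_gt0 n; have g0' := ratio_gt0 n'.
have -> : strength n - strength n' = 2 * (ratio n - ratio n') / (ratio n * ratio n').
  by rewrite /strength; field; rewrite !gt_eqF.
rewrite normrM normrM (ger0_norm (_ : 0 <= 2))// ler_piMr// ?mulr_ge0//.
rewrite normfV (gtr0_norm (mulr_gt0 g0 g0')) (invf_le1 (mulr_gt0 g0 g0')).
by rewrite mulr_ege1 ?ratio_ge1.
Qed.

(** The contribution to the ratio at the [b]-th atom of the atoms of the block of
    order [m]. *)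
Definition block_ratio m b : R :=
  (\sum_(k < 4 ^ m) bump k (pos b)) / height b.

Lemma sum_in_block (F : nat -> R) m c : (c < 4)%N ->
  \sum_(k < 4 ^ m.+1 | (k %/ 4 ^ m == c)%N) F k = \sum_(b < 4 ^ m) F (b + c * 4 ^ m)%N.
Proof.
move=> c4; rewrite big_mkcond/= (sum_block (fun k => if (k %/ 4 ^ m == c)%N then F k else 0)).
apply: eq_bigr => b _.
rewrite divn_small// !divnDMl ?expn_gt0// divn_small// !add0n.
case: c c4 => [|[|[|[|]]]]// _ /=; rewrite ?mul0n ?addn0 ?addr0 ?add0r//.
Qed.

Lemma bump_block m b b' c : (b < 4 ^ m)%N -> (b' < 4 ^ m)%N -> (c < 4)%N ->
  bump (b' + c * 4 ^ m) (pos (b + c * 4 ^ m)) / height (b + c * 4 ^ m) =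
  bump b' (pos b) / height b.
Proof.
move=> bm bm' c4; rewrite /bump !pos_block// !height_block//.
have -> : pos b + sdigit c * q m.+1 - (pos b' + sdigit c * q m.+1) = pos b - pos b' by lra.
rewrite -mulf_div mulrAC -mulrA.
have w0 : (if c == 0 then 1 else weight m) != 0.
  by case: ifP => // _; rewrite gt_eqF// expR_gt0.
have h0 : height b != 0 by rewrite gt_eqF// height_gt0.
by field; rewrite w0 h0.
Qed.

Lemma expRN_far m k n : (k %/ 4 ^ m)%N != (n %/ 4 ^ m)%N ->
  expR (- `|pos n - pos k|) <= expR (- q m.+1 + 6 * q m).
Proof.
by move=> kn; rewrite ler_expR; rewrite eq_sym in kn; have := pos_far kn; lra.
Qed.

Lemma divn_block m b c : (b < 4 ^ m)%N -> ((b + c * 4 ^ m) %/ 4 ^ m)%N = c.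
Proof. by move=> bm; rewrite divnDMl ?expn_gt0// divn_small. Qed.

(** The ratio at a translated atom is the same up to the contribution of the atoms
    outside the translated block. *)
Lemma ratio_block m b c : (b < 4 ^ m)%N -> (c < 4)%N ->
  block_ratio m b <= ratio (b + c * 4 ^ m) <=
  block_ratio m b + 2 * expR (- q m.+1 + 6 * q m) / height (b + c * 4 ^ m).
Proof.
move=> bm c4; set n := (b + c * 4 ^ m)%N.
have hn : 0 < height n := height_gt0 n.
have E : block_ratio m b =
    (\sum_(k < 4 ^ m.+1 | (k %/ 4 ^ m == c)%N) bump k (pos n)) / height n.
  rewrite (sum_in_block (bump ^~ (pos n)))// /block_ratio !mulr_suml.
  by apply: eq_bigr => k _; rewrite bump_block.
rewrite E /ratio -mulrDl !ler_pM2r ?invr_gt0//; apply/andP; split.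
  exact: (@eigfun_ge_partial (fun k => k %/ 4 ^ m == c)%N).
apply: (@eigfun_le_partial (fun k => k %/ 4 ^ m == c)%N) => k kc.
apply: expRN_far; rewrite divn_block//.
apply: contra kc => /eqP kc; rewrite kc eqxx/=.
by rewrite expnS -ltn_divLR ?expn_gt0// kc.
Qed.

Lemma strength_shift m b c c' : (b < 4 ^ m)%N -> (c < 4)%N -> (c' < 4)%N ->
  `|strength (b + c * 4 ^ m) - strength (b + c' * 4 ^ m)| <=
  4 * expR (- q m.+1 + 15 * q m).
Proof.
move=> bm c4 c4'; apply: le_trans (strength_dist _ _) _.
have hh d : (d < 4)%N ->
    2 * expR (- q m.+1 + 6 * q m) / height (b + d * 4 ^ m) <=
    2 * expR (- q m.+1 + 15 * q m).
  move=> d4; rewrite -mulrA ler_pM2l// ler_pdivrMr ?height_gt0//.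
  apply: (@le_trans _ _ (expR (- q m.+1 + 15 * q m) * expR (- (9 * q m)))).
    by rewrite -expRD ler_expR; lra.
  rewrite ler_wpM2l ?expR_ge0// height_block//.
  apply: (@le_trans _ _ (expR (- q m) * expR (- (8 * q m)))).
    by rewrite -expRD ler_expR; lra.
  apply: ler_pM; rewrite ?expR_ge0//; first exact: height_ge_block.
  case: ifP => // _; rewrite -[leRHS]expR0 ler_expR.
  by have := scale_gt0 m; lra.
have /andP[l1 u1] := ratio_block bm c4; have /andP[l2 u2] := ratio_block bm c4'.
have := hh _ c4; have := hh _ c4'.
move: (ratio _) (ratio _) l1 u1 l2 u2 => r r' l1 u1 l2 u2 h1 h2.
rewrite (_ : 4 = 2 * 2); last lra.
rewrite -mulrA ler_pM2l// ler_norml; apply/andP; split; lra.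
Qed.

(** The ratio at [q m.+1] contains the term of the atom 0, which is
    [exp (8 * q m)] times [exp (- q m.+1)]; the ratio at 0 exceeds the common part
    by at most [2 * exp (6 * q m)] times [exp (- q m.+1)]. *)
Lemma strength_gap m :
  expR (- q m.+1) / 3 <= `|strength 0 - strength (1 * 4 ^ m)|.
Proof.
have w0 : 0 < weight m by exact: expR_gt0.
have m0 : (0 < 4 ^ m)%N by rewrite expn_gt0.
have := @ratio_block m 0 0 m0 isT; rewrite mul0n addn0 height0 divr1 => /andP[l0 u0].
have g0 : ratio 0 <= 2 by rewrite /ratio height0 divr1 eigfun_le2.
have lm : block_ratio m 0 + expR (- q m.+1 + 8 * q m) <= ratio (1 * 4 ^ m).
  have -> : block_ratio m 0 + expR (- q m.+1 + 8 * q m) =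
      (\sum_(k < 4 ^ m.+1 | (k %/ 4 ^ m == 1)%N || (k == 0 :> nat)) bump k (pos (1 * 4 ^ m)))
        / height (1 * 4 ^ m).
    rewrite (bigID (fun k : 'I_(4 ^ m.+1) => (k %/ 4 ^ m == 1)%N))/= [RHS]mulrDl; congr (_ + _).
      rewrite (eq_bigl (fun k : 'I_(4 ^ m.+1) => (k %/ 4 ^ m == 1)%N)); last first.
        by move=> k; rewrite andbC; case: eqP.
      rewrite (sum_in_block (bump ^~ (pos (1 * 4 ^ m))))// /block_ratio !mulr_suml.
      apply: eq_bigr => k _.
      by have := @bump_block m 0 k 1 m0 (ltn_ord k) isT; rewrite !add0n => ->.
    have k0 : (0 < 4 ^ m.+1)%N by rewrite expn_gt0.
    rewrite (big_pred1 (Ordinal k0)); last first.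
      move=> k /=; rewrite -val_eqE/=; case: eqP => [|/eqP] k1 /=.
        by case: eqP => [k2|]//; move: k1; rewrite k2 div0n.
      by rewrite andbT.
    rewrite /bump pos0 subr0 height0 mul1r pos_pure// height_pure// /sdigit/= mul1r.
    rewrite gtr0_norm ?scale_gt0// expRD -expRN; congr (_ * expR _); lra.
  rewrite /ratio ler_pM2r ?invr_gt0 ?height_gt0//.
  exact: (@eigfun_ge_partial (fun k => (k %/ 4 ^ m == 1)%N || (k == 0))).
have key : ratio 0 + expR (- q m.+1) <= ratio (1 * 4 ^ m).
  apply: le_trans lm; move: u0; rewrite !expRD => u0.
  have e1 : 1 <= expR (8 * q m) - 2 * expR (6 * q m).
    have -> : 8 * q m = 6 * q m + 2 * q m by lra.
    rewrite expRD; have := expR_ge1Dx (2 * q m); have := expR_ge1Dx (6 * q m).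
    have := scale_ge4 m; move: (expR _) (expR _) => a b; nra.
  have := ler_wpM2l (expR_ge0 (- q m.+1)) e1; rewrite mulr1 mulrBr; lra.
have e1 : expR (- q m.+1) <= 1.
  by rewrite -[leRHS]expR0 ler_expR; have := scale_gt0 m.+1; lra.
have r0 := ratio_ge1 0; have e0 := expR_gt0 (- q m.+1).
rewrite distrC /strength.
apply: le_trans (ler_norm _); move: (ratio 0) (ratio (1 * 4 ^ m)) (expR (- q m.+1)) g0 key e1 r0 e0.
move=> r s e g0 key e1 r0 e0.
have s0 : 0 < s by lra.
have -> : - 2 / s - - 2 / r = 2 * (s - r) / (r * s) by field; rewrite !gt_eqF//; lra.
rewrite ler_pdivlMr; last by apply: mulr_gt0 => //; lra.
rewrite mulrAC ler_pdivrMr//.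
have : e * (r * s) <= e * (2 * s) by rewrite ler_wpM2l ?ler_wpM2r//; lra.
have : e * s <= 3 * (s - r) by nra.
lra.
Qed.

End atoms.

(** * Integration against finite sums of point masses *)

Section atomic_integrals.
Context {R : realType}.
Implicit Types (w z : nat -> R) (f : R -> R).

Lemma semi_sigma_additive_atoms N w z :
  semi_sigma_additive (fun A : set (measurableTypeR R) =>
    (\sum_(i < N) w i * \1_A (z i))%:E).
Proof.
elim: N => [|N IH] F mF tF mUF.
  rewrite big_ord0; under eq_fun do under eq_bigr do rewrite big_ord0.
  by under eq_fun do rewrite sumEFin big1//; exact: cvg_cst.
rewrite big_ord_recr/= EFinD.
under eq_fun.
  move=> n; under eq_bigr do rewrite big_ord_recr/= EFinD.
  rewrite big_split/=.
  have -> : (\sum_(0 <= i < n) (w N * \1_(F i) (z N))%:E =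
      (w N)%:E * \sum_(0 <= i < n) \d_(z N : measurableTypeR R) (F i))%E.
    under eq_bigr do rewrite EFinM.
    by rewrite -ge0_sume_distrr.
  over.
apply: cvgeD; first by [].
  exact: IH.
rewrite EFinM; apply: cvgeZl => //.
have := @measure_semi_sigma_additive _ (measurableTypeR R) R \d_(z N : measurableTypeR R) F mF tF mUF.
by apply: cvg_trans; apply: near_eq_cvg; apply: nearW => n; apply: eq_bigr.
Qed.

Lemma Rintegral_atomic (m : {finite_measure set (measurableTypeR R) -> \bar R})
    N w z f :
  measurable_fun setT (f : measurableTypeR R -> R) ->
  (forall A, measurable A -> m A = (\sum_(i < N) w i * \1_A (z i))%:E) ->
  Rintegral m setT f = \sum_(i < N) w i * f (z i).
Proof.
move=> mf mE; pose s := undup [seq z i | i <- iota 0 N].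
have zs (i : 'I_N) : z i \in s.
  by rewrite mem_undup; apply/mapP; exists (i : nat) => //; rewrite mem_iota/= ltn_ord.
(* [f] agrees outside a null set with a simple function; positions that occur
   several times are listed once in [s] *)
pose g x := \sum_(y <- s) f y * \1_[set y] x.
have gE y : y \in s -> g y = f y.
  move=> ys; rewrite /g (bigD1_seq y)//= ?undup_uniq// indicE mem_set// mulr1.
  rewrite big1 ?addr0// => x /eqP xy; rewrite indicE memNset ?mulr0//=.
  by move=> /esym.
have mZ : measurable ([set` s] : set (measurableTypeR R)).
  rewrite (_ : [set` s] = \big[setU/set0]_(y <- s) [set y]).
    by apply: bigsetU_measurable => y _; exact: measurable_set1.
  rewrite -bigcup_seq; apply/seteqP; split => [x xs|x [y ys ->]]//.
  by exists x.
have mg : measurable_fun setT (g : measurableTypeR R -> R).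
  apply: measurable_sum => y; apply: measurable_funM => //.
have iy y : m.-integrable setT (fun x => (\1_[set y] x)%:E : \bar R).
  by apply: integrable_indic; exact: measurable_set1.
rewrite /Rintegral (@ae_eq_integral _ _ _ m _ (EFin \o g) (EFin \o f))//=; last 3 first.
- exact/measurable_EFinP.
- exact/measurable_EFinP.
- exists (~` [set` s]); split; first exact: measurableC.
    apply: (etrans (mE _ (measurableC mZ))).
    by rewrite big1// => i _; rewrite indicE memNset ?mulr0//=; apply; exact: zs.
  by move=> x /= /not_implyP[_ fg]; apply: contra_not fg => xs; rewrite gE.
under eq_integral do rewrite -sumEFin.
rewrite integral_sum//=; last first.
  move=> y; under eq_fun do rewrite EFinM; exact: integrableZl.
have intE y : (\int[m]_x (f y * \1_[set y] x)%:E =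
    (f y * (\sum_(i < N) w i * \1_[set y] (z i)))%:E)%E.
  under eq_integral do rewrite EFinM.
  rewrite (integralZl _ (iy y))// integral_indic// setIT.
  by rewrite EFinM; congr (_ * _)%E; exact: (mE _ (measurable_set1 y)).
under eq_bigr do rewrite intE.
rewrite sumEFin/=.
under eq_bigr do rewrite mulr_sumr.
rewrite exchange_big/=; apply: eq_bigr => i _.
rewrite -(gE _ (zs i)) /g mulr_sumr; apply: eq_bigr => y _.
rewrite mulrCA; congr (_ * (_ * _)); rewrite !indicE; congr (_%:R).
Qed.

(** Both Jordan parts of an atomic charge are atomic measures, with masses
    [w i * \1_P (z i)] and [- w i * \1_Q (z i)] for the Hahn decomposition [P], [Q]. *)
Lemma charge_int_atomic (c : {charge set (measurableTypeR R) -> \bar R}) N w z f :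
  measurable_fun setT (f : measurableTypeR R -> R) ->
  (forall A, measurable A -> c A = (\sum_(i < N) w i * \1_A (z i))%:E) ->
  charge_int c f = \sum_(i < N) w i * f (z i).
Proof.
move=> mf cE; rewrite /charge_int; move: (svalP (cid (svalP (cid (Hahn_decomposition c))))).
set P := sval _; set Q := sval _ => PQ; have [posP negQ PQT PQ0] := PQ.
have [mP _] := posP; have [mQ _] := negQ.
have capE (B : set (measurableTypeR R)) w' A : \sum_(i < N) w' i * \1_(A `&` B) (z i) =
    \sum_(i < N) (w' i * \1_B (z i)) * \1_A (z i).
  by apply: eq_bigr => i _; rewrite indicI/= mulrCA mulrC.
rewrite (@Rintegral_atomic _ N (fun i => w i * \1_P (z i)) z)//; last first.
  move=> A mA; rewrite [LHS](_ : _ = if A \in measurable then c (A `&` P) else 0%E)// mem_set//.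
  by rewrite cE ?capE//; exact: measurableI.
rewrite (@Rintegral_atomic _ N (fun i => - (w i * \1_Q (z i))) z)//; last first.
  move=> A mA; rewrite [LHS](_ : _ = (-1)%:E * (if A \in measurable then c (A `&` Q) else 0))%E//.
  rewrite mem_set// mulN1e.
  rewrite cE ?capE; last exact: measurableI.
  by rewrite -EFinN -sumrN; congr (_%:E); apply: eq_bigr => i _; rewrite mulNr.
rewrite -sumrB; apply: eq_bigr => i _; rewrite mulNr opprK -mulrDl -mulrDr.
suff -> : \1_P (z i) + \1_Q (z i) = 1 :> R by rewrite mulr1.
rewrite !indicE; have : [set: R] (z i) by []. 
rewrite -PQT => -[Pz|Qz].
  rewrite mem_set// memNset ?addr0// => Qz.
  by have : (P `&` Q) (z i) by []; rewrite PQ0.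
rewrite (mem_set Qz) memNset ?add0r// => Pz.
by have : (P `&` Q) (z i) by []; rewrite PQ0.
Qed.

End atomic_integrals.

Section complex_atomic.
Context {R : realType}.
Implicit Types (w z : nat -> R).
Local Open Scope complex_scope.

Lemma sum_complex N (a b : nat -> R) :
  \sum_(i < N) (a i +i* b i) = (\sum_(i < N) a i) +i* (\sum_(i < N) b i).
Proof.
elim: N => [|N IH]; first by rewrite !big_ord0.
by rewrite !big_ord_recr/= IH.
Qed.

Lemma support_notin (u : R -> R[i]) x : ~ support u x -> u x = 0.
Proof.
move=> nux; apply/eqP/negPn/negP => ux; apply: nux.
exact: subset_closure.
Qed.

Lemma lm_int_atomic (nu : local_measure R) (u : R -> R[i]) N w z :
  compact (support u) ->
  measurable_fun setT (re_part u : measurableTypeR R -> R) ->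
  measurable_fun setT (im_part u : measurableTypeR R -> R) ->
  (forall A, nu (A `&` support u) =
     (\sum_(i < N) w i * \1_(A `&` support u) (z i))%:C) ->
  lm_int nu u = \sum_(i < N) (w i)%:C * u (z i).
Proof.
move=> cK mr mi nuE; rewrite /lm_int; case: pselect => // cK'.
pose w' i := w i * \1_(support u) (z i).
have w'E A : \sum_(i < N) w i * \1_(A `&` support u) (z i) =
    \sum_(i < N) w' i * \1_A (z i).
  by apply: eq_bigr => i _; rewrite indicI/= mulrCA mulrC.
have re f : measurable_fun setT (f : measurableTypeR R -> R) ->
    charge_int (lm_restr_Re nu cK') f = \sum_(i < N) w' i * f (z i).
  move=> mf; apply: charge_int_atomic => // A mA.
  by rewrite /= /lm_restr_Re nuE/= w'E.
have im f : measurable_fun setT (f : measurableTypeR R -> R) ->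
    charge_int (lm_restr_Im nu cK') f = 0.
  move=> mf; rewrite (@charge_int_atomic _ _ 0 (fun=> 0) (fun=> 0))//; first by rewrite big_ord0.
  by move=> A mA; rewrite /= /lm_restr_Im nuE/= big_ord0.
rewrite !re// !im// subr0 addr0 -(sum_complex N (fun i => w' i * re_part u (z i)) (fun i => w' i * im_part u (z i))); apply: eq_bigr => i _.
rewrite /re_part /im_part /w' indicE; case: (asboolP (support u (z i))) => ui.
  rewrite mem_set// !mulr1; case: (u (z i)) => a b /=.
  by rewrite /GRing.mul/= !mul0r subr0 addr0.
by rewrite memNset// (support_notin ui) /= !mulr0.
Qed.

End complex_atomic.

(** * The measure *)

Section gordon_measure.
Context {R : realType}.
Local Open Scope complex_scope.
Local Notation q := (@scale R).

Lemma pos_escape (B : R) : exists N, forall n, (N <= n)%N -> B < `|@pos R n|.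
Proof.
exists (4 ^ Num.bound `|B|)%N => n /(@pos_far_nat R); apply: lt_le_trans.
exact: le_lt_trans (ler_norm _) (archi_boundP (normr_ge0 B)).
Qed.

Lemma pos_escape_compact (K : set R) : compact K ->
  exists N, forall n, (N <= n)%N -> ~ K (pos n).
Proof.
move=> /compact_bounded[M [_ /(_ (M + 1))]].
rewrite ltrDl ltr01 => /(_ isT) KM.
have [N NM] := pos_escape (M + 1); exists N => n /NM + /KM /=.
by rewrite ltNge => /negP.
Qed.

(** The mass that the first [N] atoms give to [A]. *)
Definition atom_mass N (A : set R) : R :=
  \sum_(n < N) strength n * \1_A (pos n).

(** The set function [sum_n strength n * \d_(pos n)].  On a bounded set only
    finitely many atoms count; the limit is of no significance on other sets. *)
Definition gordon_fun (A : set (measurableTypeR R)) : R[i] :=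
  (limn (atom_mass ^~ A))%:C.

Lemma gordon_funE N (A : set R) : (forall n, (N <= n)%N -> ~ A (pos n)) ->
  gordon_fun A = (atom_mass N A)%:C.
Proof.
move=> AN; congr (_%:C); apply: lim_near_cst => //; near=> M.
apply: (big_ord_trunc _ (F := fun n => strength n * \1_A (pos n))).
  by near: M; exact: nbhs_infty_ge.
by move=> k /AN Ak; rewrite indicE memNset ?mulr0.
Unshelve. all: by end_near. Qed.

Lemma gordon_set0 : gordon_fun set0 = 0.
Proof. by rewrite (@gordon_funE 0 set0 (fun _ _ h => h)) /atom_mass big_ord0. Qed.

Lemma gordon_cap (K : set R) N : (forall n, (N <= n)%N -> ~ K (pos n)) ->
  forall A, gordon_fun (A `&` K) =
   (\sum_(n < N) (strength n * \1_K (pos n)) * \1_A (pos n))%:C.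
Proof.
move=> KN A; rewrite (@gordon_funE N) => [|n /KN Kn [_ //]].
by congr (_%:C); apply: eq_bigr => n _; rewrite indicI/= mulrCA mulrC.
Qed.

Lemma gordon_Re (K : set R) : compact K ->
  semi_sigma_additive (fun A : set (measurableTypeR R) =>
    (complex.Re (gordon_fun (A `&` K)))%:E).
Proof.
move=> /pos_escape_compact[N KN].
under eq_fun do rewrite (gordon_cap KN)/=.
exact: (@semi_sigma_additive_atoms R N (fun n => strength n * \1_K (pos n)) pos).
Qed.

Lemma gordon_Im (K : set R) : compact K ->
  semi_sigma_additive (fun A : set (measurableTypeR R) =>
    (complex.Im (gordon_fun (A `&` K)))%:E).
Proof.
move=> _; have := @semi_sigma_additive_atoms R 0 (fun=> 0) (fun=> 0).
by under eq_fun do rewrite big_ord0.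
Qed.

Definition gordon : local_measure R :=
  LocalMeasure gordon_set0 gordon_Re gordon_Im.

Lemma sum_indic_partition n (F : 'I_n -> set R) (A : set R) x :
  trivIset setT F -> \bigcup_(i in setT) F i = A ->
  \sum_(i < n) \1_(F i) x <= \1_A x :> R.
Proof.
move=> tF FA; have [Ax|nAx] := pselect (A x); last first.
  rewrite big1// => i _; rewrite indicE memNset// => Fx; apply: nAx.
  by rewrite -FA; exists i.
rewrite indicE mem_set//; move: Ax; rewrite -FA => -[i _ Fx].
rewrite (bigD1 i)//= indicE mem_set// big1 ?addr0// => j ji.
rewrite indicE memNset// => Fj; move/eqP: ji; apply.
by apply: (tF j i) => //; exists x.
Qed.

Lemma count_block K N c : (0 < K)%N -> (\sum_(n < N) (n %/ K == c) <= K)%N.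
Proof.
case: K => // K _.
rewrite (eq_bigr (fun n : 'I_N => if (n %/ K.+1 == c)%N then 1 else 0)%N); last first.
  by move=> n _; case: ifP.
rewrite -big_mkcond sum1dep_card -[leqRHS]card_ord.
rewrite -(card_in_imset (f := fun n : 'I_N => inord (n %% K.+1) : 'I_K.+1)); first exact: max_card.
move=> i j; rewrite !inE => /eqP ic /eqP jc /(congr1 val) /=; rewrite !inordK ?ltn_mod// => ij.
by apply: val_inj; rewrite /= (divn_eq i K.+1) (divn_eq j K.+1) ic jc ij.
Qed.

Lemma normc_ge0 (x : R[i]) : 0 <= normc x.
Proof. by case: x => a b; exact: sqrtr_ge0. Qed.

Lemma normcR (x : R) : normc (x%:C) = `|x|.
Proof. by rewrite /= expr0n/= addr0 sqrtr_sqr. Qed.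

(** A bounded set that meets a single block of order [m] has variation at most
    [2 * 4 ^ m]. *)
Lemma total_variation_block m (A : set R) N :
  (forall n, (N <= n)%N -> ~ A (pos n)) ->
  (forall n n', A (pos n) -> A (pos n') -> (n %/ 4 ^ m = n' %/ 4 ^ m)%N) ->
  (total_variation gordon A <= (2 * 4 ^+ m)%:E)%E.
Proof.
move=> AN Am; apply: ge_ereal_sup => _ [k [F [mF tF FA ->]]].
rewrite sumEFin lee_fin.
have FE i : gordon (F i) = (atom_mass N (F i))%:C.
  rewrite /= (@gordon_funE N)// => n /AN An Fn; apply: An.
  by rewrite -FA; exists i.
under eq_bigr do rewrite FE normcR.
apply: (@le_trans _ _ (\sum_(i < k) \sum_(n < N) 2 * \1_(F i) (pos n))).
  apply: ler_sum => i _; apply: (le_trans (ler_norm_sum _ _ _)).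
  apply: ler_sum => n _; rewrite normrM (ger0_norm (_ : 0 <= \1_(F i) _))//.
  by rewrite ler_wpM2r// strength_le2.
rewrite exchange_big/=; under eq_bigr do rewrite -mulr_sumr.
rewrite -mulr_sumr ler_pM2l//.
apply: (@le_trans _ _ (\sum_(n < N) \1_A (pos n))).
  by apply: ler_sum => n _; exact: sum_indic_partition.
have [[n0 An0]|nA] := pselect (exists n, A (pos n)); last first.
  rewrite big1 ?exprn_ge0// => n _; rewrite indicE memNset// => An.
  by apply: nA; exists n.
apply: (@le_trans _ _ (\sum_(n < N) (n %/ 4 ^ m == n0 %/ 4 ^ m)%N%:R)).
  apply: ler_sum => n _; rewrite indicE; case: (asboolP (A (pos n))) => An.
    by rewrite (Am _ _ An An0) eqxx mem_set.
  by rewrite memNset// ler0n.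
rewrite -natr_sum -natrX ler_nat; apply: count_block; exact: expn_gt0.
Qed.

Lemma total_variation_itv m (a r : R) : r <= q m.+1 - 6 * q m ->
  (total_variation gordon `]a, (a + r)%R] <= (2 * 4 ^+ m)%:E)%E.
Proof.
move=> rm; have [N NE] := pos_escape (`|a| + `|a + r|).
apply: (@total_variation_block m _ N).
  move=> n /NE; rewrite ltNge => /negP h /=; rewrite in_itv/= => /andP[/ltW a1 a2]; apply: h.
  rewrite ler_norml; have := ler_norm (a + r); have := ler_norm (- a).
  rewrite normrN; have := normr_ge0 a; have := normr_ge0 (a + r).
  by move=> *; apply/andP; split; lra.
move=> n n' /=; rewrite !in_itv/= => /andP[a1 a2] /andP[b1 b2].
apply/eqP; apply: contraT => /(@pos_far R); apply: contraTT => _.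
by rewrite -ltNge; apply: lt_le_trans rm; rewrite ltr_norml; apply/andP; split; lra.
Qed.

Lemma gordon_unif : in_Mlocunif gordon.
Proof.
apply: (@le_lt_trans _ _ (2 * 4 ^+ 0)%:E); last exact: ltry.
apply: ge_ereal_sup => _ [a _ <-]; apply: total_variation_itv.
by have := @scale_leS R 0; have := @scale_ge4 R 0; lra.
Qed.

Lemma total_variation_ge0 (mu : local_measure R) (A : set R) : measurable (A : set (measurableTypeR R)) ->
  (0 <= total_variation mu A)%E.
Proof.
move=> mA; apply: (@le_trans _ _ (normc (mu A))%:E); first by rewrite lee_fin normc_ge0.
apply: ereal_sup_ubound; exists 1%N, (fun=> A); split => //.
- by apply/trivIsetP => i j _ _; rewrite !ord1 eqxx.
- by rewrite bigcup_const//; exists ord0.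
- by rewrite big_ord1.
Qed.

Lemma gordon_inf_unif : inf_unif_normr gordon = 0%E.
Proof.
apply/eqP; rewrite eq_le; apply/andP; split; last first.
  apply: le_ereal_inf_tmp => _ [r /= r0 <-]; rewrite mule_ge0//.
    by rewrite lee_fin invr_ge0 ltW.
  apply: (@le_trans _ _ (total_variation gordon `]0, 0 + r])).
    exact: total_variation_ge0.
  by apply: ereal_sup_ubound; exists 0.
apply/lee_addgt0Pr => e e0; rewrite add0e.
pose m := Num.bound e^-1; pose r := q m.+1 / 2.
have Qm := @scale_leS R m; have Qm4 := @scale_ge4 R m.
have r0 : 0 < r by rewrite /r; lra.
apply: (@le_trans _ _ (unif_normr gordon r)); first by apply: ereal_inf_lbound; exists r.
apply: (@le_trans _ _ (r^-1%:E * (2 * 4 ^+ m)%:E)%E).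
  rewrite lee_pmul2l ?lte_fin ?invr_gt0//; apply: ge_ereal_sup => _ [a _ <-].
  by apply: total_variation_itv; rewrite /r; lra.
rewrite -EFinM lee_fin mulrC ler_pdivrMr// /r.
have em : e^-1 < m%:R by apply: archi_boundP; rewrite invr_ge0 ltW.
have qm : 4 * 4 ^+ m <= q m.
  apply: le_trans (@scale_ge_expn R m); rewrite ler_pM2l//.
  by rewrite lerXn2r// ?nnegrE//; lra.
have e1 : 1 <= e * m%:R.
  by rewrite -ler_pdivrMl// mulr1 ltW.
rewrite scaleS; have : 0 <= 4 ^+ m :> R by rewrite exprn_ge0.
move: (q m) (4 ^+ m) (m%:R) qm e1 Qm4 => x y z qm e1 Qm4 y0.
have : x <= (e * z) * x by rewrite ler_peMl//; lra.
have : 0 <= e * x by rewrite mulr_ge0; lra.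
nra.
Qed.

End gordon_measure.

(** * The eigenvalue equation *)

Section green.
Context {R : realType}.
Local Notation leb := (@lebesgue_measure R).
Implicit Types f g F : R -> R.

Lemma integrable_csupport f (M : R) : continuous f ->
  (forall x, M < `|x| -> f x = 0) ->
  leb.-integrable setT (EFin \o f) /\
  Rintegral leb setT f = Rintegral leb `[- M, M] f.
Proof.
move=> cf f0; have fE : f \_ `[- M, M] = f.
  apply/funext => x; rewrite patchE; case: ifPn => // /negP xM.
  rewrite f0// ltNge; apply/negP => h; apply: xM.
  by rewrite inE/= in_itv/= -ler_norml.
split; last by rewrite [RHS]Rintegral_mkcond fE.
have : leb.-integrable (setT `&` `[- M, M]) (EFin \o f).
  rewrite setTI; apply: continuous_compact_integrable; first exact: segment_compact.
  exact: continuous_subspaceT.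
move=> /integrable_restrict; rewrite restrict_EFin fE; exact.
Qed.

Lemma Rintegral_FTC f F (a b : R) : a < b -> continuous f ->
  (forall x : R, is_derive x 1 F (f x)) -> Rintegral leb `[a, b] f = F b - F a.
Proof.
move=> ab cf dF; have cF : continuous F.
  by move=> x; apply/differentiable_continuous/derivable1_diffP; case: (dF x).
rewrite /Rintegral (@continuous_FTC2 _ f F)//.
- exact: continuous_subspaceT.
- split.
  + by move=> x _; case: (dF x).
  + exact/cvg_at_right_filter/cF.
  + exact/cvg_at_left_filter/cF.
- by move=> x _; rewrite derive1E derive_val.
Qed.

Lemma expR_abs_continuous (y : R) : continuous (fun x : R => expR (- `|x - y|)).
Proof.
move=> x; apply: continuous_comp; last exact: continuous_expR.
apply: cvgN; apply: cvg_norm; apply: cvgB; [exact: cvg_id|exact: cvg_cst].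
Qed.

Lemma derive1_csupport f (M : R) : (forall x, M < `|x| -> f x = 0) ->
  forall x, M < `|x| -> derive1 f x = 0.
Proof.
move=> f0 x Mx; rewrite derive1E (_ : 'D_1 f x = 'D_1 (cst 0 : R -> R) x).
  exact: derive_cst.
apply: near_eq_derive; near=> z; rewrite f0//.
by near: z; apply: (cvgr_gt `|x|) => //; exact: norm_continuous.
Unshelve. all: by end_near. Qed.

Lemma measurable_expR_abs (y : R) :
  measurable_fun setT ((fun x => expR (- `|x - y|)) : measurableTypeR R -> R).
Proof. by apply: continuous_measurable_fun; exact: expR_abs_continuous. Qed.

Lemma measurable_eigfun : measurable_fun setT (eigfun : measurableTypeR R -> R).
Proof. by apply: continuous_measurable_fun; exact: eigfun_continuous. Qed.

Lemma measurable_bump n : measurable_fun setT (bump n : measurableTypeR R -> R).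
Proof. by apply: measurable_funM => //; exact: measurable_expR_abs. Qed.

Lemma measurable_bump_sum k : measurable_fun setT (bump_sum k : measurableTypeR R -> R).
Proof. by apply: measurable_sum => n; exact: measurable_bump. Qed.

(** [x |-> exp (- |x - y|) / 2] is the Green function of [1 - d^2/dx^2].  The integrand
    has the antiderivative [exp (x - y) * (psi' x - psi x)] to the left of [y] and
    [exp (y - x) * (psi' x + psi x)] to the right of [y]. *)
Lemma green_identity (psi : R -> R) (M y : R) :
  (forall n x, derivable (derive1n n psi) x 1) ->
  (forall x, M < `|x| -> psi x = 0) ->
  Rintegral leb setT (fun x => expR (- `|x - y|) * (derive1n 2 psi x - psi x)) =
  - 2 * psi y.
Proof.
move=> dpsi psi0; pose psi1 := derive1n 1 psi; pose psi2 := derive1n 2 psi.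
have d0 (x : R) : is_derive x 1 psi (psi1 x).
  by apply: DeriveDef; [exact: (dpsi 0%N)|rewrite /psi1 /= derive1E].
have d1 (x : R) : is_derive x 1 psi1 (psi2 x).
  by apply: DeriveDef; [exact: (dpsi 1%N)|rewrite /psi1 /psi2 /= [RHS]derive1E].
have cont n : continuous (derive1n n psi).
  by move=> x; apply/differentiable_continuous/derivable1_diffP; exact: dpsi.
have psi1_0 : forall x, M < `|x| -> psi1 x = 0 := derive1_csupport psi0.
have psi2_0 : forall x, M < `|x| -> psi2 x = 0 := derive1_csupport psi1_0.
pose K := Num.max M `|y| + 1.
have yK : `|y| < K by rewrite /K ltr_pwDr// le_max lexx orbT.
have MK : M < K by rewrite /K ltr_pwDr// le_max lexx.
have [Ky yK'] : - K < y /\ y < K by apply/andP; rewrite -ltr_norml.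
pose g x := psi2 x - psi x.
have cg : continuous g by move=> x; apply: cvgB; [exact: (cont 2%N)|exact: (cont 0%N)].
pose f x := expR (- `|x - y|) * g x.
have cf : continuous f by move=> x; apply: cvgM; [exact: expR_abs_continuous|exact: cg].
have f0 x : K < `|x| -> f x = 0.
  move=> /(lt_trans MK) Mx.
  by rewrite /f /g (psi0 _ Mx) (psi2_0 _ Mx) subrr mulr0.
have [intf ->] := integrable_csupport cf f0.
have intK : leb.-integrable `[- K, K] (EFin \o f) by apply: integrableS intf.
have := @Rintegral_itvB R f (BLeft (- K)) (BRight K) y intK.
rewrite !bnd_simp (ltW Ky) (ltW yK') => /(_ isT isT) split_int.
rewrite Rintegral_itv_obnd_cbnd in split_int; last first.
  apply: integrableS intK => //; apply: subset_itv; rewrite bnd_simp//; exact: ltW.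
pose f1 x := expR (x - y) * g x; pose f2 x := expR (y - x) * g x.
have e1 : Rintegral leb `[- K, y] f = psi1 y - psi y.
  have -> : Rintegral leb `[- K, y] f = Rintegral leb `[- K, y] f1.
    apply: eq_Rintegral => x; rewrite inE/= in_itv/= => /andP[_ xy].
    by rewrite /f /f1 ler0_norm ?opprK// subr_le0.
  have cf1 : continuous f1.
    move=> x; apply: cvgM; last exact: cg.
    apply: continuous_comp; last exact: continuous_expR.
    by apply: cvgB; [exact: cvg_id|exact: cvg_cst].
  have dF1 (x : R) : is_derive x 1 (fun x : R => expR (x - y) * (psi1 x - psi x)) (f1 x).
    by apply: is_derive_eq; rewrite /f1 /g /GRing.scale/=; ring.
  rewrite (Rintegral_FTC Ky cf1 dF1) subrr expR0 mul1r.
  have MnK : M < `|- K| by rewrite normrN (lt_le_trans MK)// ler_norm.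
  by rewrite (psi0 _ MnK) (psi1_0 _ MnK) subrr mulr0 subr0.
have e2 : Rintegral leb `[y, K] f = - (psi1 y + psi y).
  have -> : Rintegral leb `[y, K] f = Rintegral leb `[y, K] f2.
    apply: eq_Rintegral => x; rewrite inE/= in_itv/= => /andP[yx _].
    by rewrite /f /f2 ger0_norm ?opprB// subr_ge0.
  have cf2 : continuous f2.
    move=> x; apply: cvgM; last exact: cg.
    apply: continuous_comp; last exact: continuous_expR.
    by apply: cvgB; [exact: cvg_cst|exact: cvg_id].
  have dF2 (x : R) : is_derive x 1 (fun x : R => expR (y - x) * (psi1 x + psi x)) (f2 x).
    by apply: is_derive_eq; rewrite /f2 /g /GRing.scale/=; ring.
  rewrite (Rintegral_FTC yK' cf2 dF2) subrr expR0 mul1r.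
  have MnK : M < `|K| by rewrite (lt_le_trans MK)// ler_norm.
  by rewrite (psi0 _ MnK) (psi1_0 _ MnK) addr0 mulr0 sub0r.
rewrite -/f; move: split_int; rewrite e1 e2; lra.
Unshelve. all: by end_near. Qed.

(** The equation [u'' - u = u mu] in weak form: summing the Green
    identities gives [- 2 * sum_n height n * psi (pos n)], and
    [- 2 * height n = strength n * eigfun (pos n)]. *)
Lemma eigfun_weak (psi : R -> R) (M : R) N :
  (forall n x, derivable (derive1n n psi) x 1) ->
  (forall x, M < `|x| -> psi x = 0) ->
  (forall n, (N <= n)%N -> M < `|@pos R n|) ->
  Rintegral leb setT (fun x => eigfun x * (derive1n 2 psi x - psi x)) =
  \sum_(n < N) strength n * (eigfun (pos n) * psi (pos n)).
Proof.
move=> dpsi psi0 NM; pose g x := derive1n 2 psi x - psi x.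
have cont n : continuous (derive1n n psi).
  by move=> x; apply/differentiable_continuous/derivable1_diffP; exact: dpsi.
have cg : continuous g by move=> x; apply: cvgB; [exact: (cont 2%N)|exact: (cont 0%N)].
have g0 x : M < `|x| -> g x = 0.
  move=> Mx; rewrite /g psi0// subr0.
  exact: derive1_csupport (derive1_csupport psi0) _ Mx.
have int_bump n : leb.-integrable setT (fun x => (expR (- `|x - pos n|) * g x)%:E) /\
    (\int[leb]_x (expR (- `|x - pos n|) * g x)%:E = (- 2 * psi (pos n))%:E)%E.
  have [||i _] := @integrable_csupport (fun x => expR (- `|x - pos n|) * g x) M.
  - by move=> x; apply: cvgM; [exact: expR_abs_continuous|exact: cg].
  - by move=> x /g0 ->; rewrite mulr0.
  - split => //; rewrite -(green_identity _ dpsi psi0) /Rintegral fineK//.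
    exact: integrable_fin_num.
have mbump := measurable_bump_sum.
have meig := measurable_eigfun.
have mg : measurable_fun setT (g : measurableTypeR R -> R).
  by apply: continuous_measurable_fun; exact: cg.
have idom : leb.-integrable setT (fun x => (2 * `|g x|)%:E).
  apply: (@integrable_csupport (fun x => 2 * `|g x|) M _ _).1.
    move=> x; apply: cvgM; first exact: cvg_cst.
    by apply: cvg_norm; exact: cg.
  by move=> x /g0 ->; rewrite normr0 mulr0.
have [||||| _ _ cv] := @dominated_convergence _ _ _ leb setT measurableT
  (fun k x => (bump_sum k x * g x)%:E) (fun x => (eigfun x * g x)%:E)
  (fun x => (2 * `|g x|)%:E).
- by move=> k; exact/measurable_EFinP/measurable_funM.
- exact/measurable_EFinP/measurable_funM.
- apply: aeW => x _; apply: cvg_EFin; first exact: nearW.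
  by apply: cvgM; [exact: bump_sum_cvg|exact: cvg_cst].
- exact: idom.
- apply: aeW => x k _; rewrite lee_fin normrM ler_wpM2r//.
  by rewrite ger0_norm ?bump_sum_ge0// bump_sum_le2.
have partial k : (\int[leb]_x (bump_sum k x * g x)%:E =
    (\sum_(n < k) - 2 * height n * psi (pos n))%:E)%E.
  under eq_integral.
    move=> x _; rewrite /bump_sum mulr_suml -sumEFin.
    under eq_bigr do rewrite /bump -mulrA EFinM.
    over.
  rewrite integral_sum//=; last by move=> n; apply: integrableZl => //; exact: (int_bump n).1.
  rewrite -sumEFin; apply: eq_bigr => n _.
  rewrite integralZl//; last exact: (int_bump n).1.
  by rewrite (int_bump n).2 -EFinM; congr (_%:E); ring.
rewrite /Rintegral; suff -> : (\int[leb]_x (eigfun x * g x)%:E =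
    (\sum_(n < N) strength n * (eigfun (pos n) * psi (pos n)))%:E)%E by [].
rewrite -(cvg_lim _ cv)//; apply: lim_near_cst => //; near=> k.
rewrite /= partial; congr (_%:E).
under [RHS]eq_bigr do rewrite mulrA strength_eigfun.
apply: (big_ord_trunc _ (F := fun n => - 2 * height n * psi (pos n))).
  by near: k; exact: nbhs_infty_ge.
by move=> n /NM /psi0 ->; rewrite mulr0.
Unshelve. all: by end_near. Qed.

End green.

Section eigenvalue.
Context {R : realType}.
Local Open Scope complex_scope.
Local Notation leb := (@lebesgue_measure R).

(** The eigenfunction as a complex-valued function. *)
Definition ceigfun (x : R) : R[i] := (eigfun x)%:C.

Lemma expR_half_integral (c : R) :
  (\int[leb]_(x in `[c, +oo[) (expR (c - x))%:E = 1)%E.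
Proof.
have cont : continuous (fun x : R => expR (c - x)).
  move=> x; apply: continuous_comp; last exact: continuous_expR.
  by apply: cvgB; [exact: cvg_cst|exact: cvg_id].
have dF (x : R) : is_derive x 1 (fun x => - expR (c - x)) (expR (c - x)).
  by apply: is_derive_eq; rewrite /GRing.scale/=; ring.
rewrite (@ge0_continuous_FTC2y _ _ (fun x => - expR (c - x)) _ 0).
- by rewrite subrr expR0 -EFinB sub0r opprK.
- by move=> x _; exact: expR_ge0.
- exact: continuous_subspaceT.
- rewrite -oppr0; apply: cvgN; under eq_fun do rewrite expRD.
  rewrite -(mulr0 (expR c)); apply: cvgM; first exact: cvg_cst.
  exact: cvgr_expR.
- by move=> x _; case: (dF x).
- apply/cvg_at_right_filter; apply: cvgN; exact: cont.
- by move=> x _; rewrite derive1E derive_val.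
Qed.

Lemma expR_abs_integral (y : R) : (\int[leb]_x (expR (- `|x - y|))%:E <= 2%:E)%E.
Proof.
have mf (D : set R) : measurable_fun (D : set (measurableTypeR R))
    (fun x : R => (expR (- `|x - y|))%:E).
  by apply/measurable_EFinP; apply: measurable_funTS; exact: measurable_expR_abs.
have setE : [set: R] = `]-oo, y] `|` `]y, +oo[.
  apply/seteqP; split => // x _; rewrite /= !in_itv/= andbT.
  by case: (leP x y); [left|right].
rewrite setE ge0_integral_setU//; last first.
  apply/disj_setPS => x [] /=; rewrite !in_itv/= andbT => xy yx.
  by move: (le_lt_trans xy yx); rewrite ltxx.
rewrite integral_itv_obnd_cbnd; last exact: mf.
have -> : (\int[leb]_(x in `[y, +oo[) (expR (- `|x - y|))%:E = 1)%E.
  rewrite -[RHS](expR_half_integral y); apply: eq_integral => x.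
  rewrite inE/= in_itv/= andbT => yx.
  by rewrite ger0_norm ?subr_ge0// opprB.
suff -> : (\int[leb]_(x in `]-oo, y]) (expR (- `|x - y|))%:E = 1)%E.
  by rewrite -EFinD lee_fin.
rewrite -[y in `]-oo, y]]opprK ge0_integration_by_substitutionNy//; last first.
  by apply: continuous_subspaceT; exact: expR_abs_continuous.
rewrite -[RHS](expR_half_integral (- y)); apply: eq_integral => x.
rewrite inE/= in_itv/= andbT => yx; congr (expR _)%:E.
by rewrite /= ler0_norm ?opprK//; lra.
Qed.

Lemma eigfun_integral : (\int[leb]_x (eigfun x)%:E <= 4%:E)%E.
Proof.
have mb n : measurable_fun setT (fun x : measurableTypeR R => (bump n x)%:E).
  by apply/measurable_EFinP; exact: measurable_bump.
have mbump k : measurable_fun setT (fun x : measurableTypeR R => (bump_sum k x)%:E).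
  by apply/measurable_EFinP; exact: measurable_bump_sum.
have limE x : limn (fun k => (bump_sum k x)%:E) = (eigfun x)%:E.
  apply/cvg_lim => //; apply: cvg_EFin; first exact: nearW.
  exact: bump_sum_cvg.
under eq_integral do rewrite -limE.
have cv := @cvg_monotone_convergence _ _ _ leb setT measurableT
   (fun k x => (bump_sum k x)%:E) mbump
   (fun k x _ => bump_sum_ge0 k x) (fun x _ k l kl => bump_sum_nd x kl).
rewrite -(cvg_lim _ cv)//; apply: lime_le; first by apply/cvg_ex; eexists; exact: cv.
apply: nearW => k; under eq_integral do rewrite -sumEFin.
rewrite ge0_integral_sum//; last by move=> n x _; rewrite lee_fin bump_ge0.
apply: (@le_trans _ _ (\sum_(n < k) (height n * 2)%:E)%E).
  apply: lee_sum => n _; under eq_integral do rewrite EFinM.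
  rewrite ge0_integralZl//; last 2 first.
  - by apply/measurable_EFinP; exact: measurable_expR_abs.
  - by rewrite lee_fin ltW// height_gt0.
  rewrite EFinM lee_wpmul2l ?expR_abs_integral// lee_fin ltW// height_gt0//.
rewrite sumEFin lee_fin -mulr_suml.
have := @sum_height R k; lra.
Qed.

Lemma ceigfun_L2 : L2 ceigfun.
Proof.
have meig := @measurable_eigfun R.
split; [exact: meig|exact: measurable_cst|].
rewrite /finite_norm unlock; apply: poweR_lty.
apply: (@le_lt_trans _ _ (2%:E * \int[leb]_x (eigfun x)%:E)%E); last first.
  by apply: (@le_lt_trans _ _ (2%:E * 4%:E)%E); rewrite ?lee_pmul2l ?eigfun_integral// -EFinM ltry.
rewrite -ge0_integralZl//; last 2 first.
- exact/measurable_EFinP.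
- by move=> x _; rewrite lee_fin ltW// eigfun_gt0.
have pE x : (`|(normc (ceigfun x))%:E| `^ 2 = (eigfun x ^+ 2)%:E)%E.
  rewrite /ceigfun normcR gtr0_norm ?eigfun_gt0// gee0_abs ?lee_fin ?(ltW (eigfun_gt0 _))//.
  by rewrite poweR_EFin powR_mulrn// ltW// eigfun_gt0.
apply: (@le_trans _ _ (\int[leb]_x (eigfun x ^+ 2)%:E)%E).
  by rewrite le_eqVlt; apply/orP; left; apply/eqP; apply: eq_integral => x _; exact: pE.
apply: ge0_le_integral => //.
- by move=> x _; rewrite lee_fin exprn_ge0// ltW// eigfun_gt0.
- by apply/measurable_EFinP; exact: measurable_funX.
- by apply/measurable_EFinP; exact: measurable_funM.
- move=> x _; rewrite -EFinM lee_fin expr2 ler_wpM2r ?eigfun_le2//.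
  exact/ltW/eigfun_gt0.
Qed.

Lemma L2N1 (u : R -> R[i]) : L2 u -> L2 (fun x => -1 * u x).
Proof.
move=> [mr mi fu].
have rN : re_part (fun x => -1 * u x) = \- re_part u.
  by apply/funext => x; rewrite /re_part/= mulN1r; case: (u x) => a b.
have iN : im_part (fun x => -1 * u x) = \- im_part u.
  by apply/funext => x; rewrite /im_part/= mulN1r; case: (u x) => a b.
split; rewrite ?rN ?iN; [exact: measurable_funN|exact: measurable_funN|].
rewrite (_ : (fun x => normc _) = (fun x => normc (u x)))//.
by apply/funext => x; rewrite mulN1r normcN.
Qed.

Lemma ceigfunM x (z : R[i]) :
  ceigfun x * z = (eigfun x * complex.Re z) +i* (eigfun x * complex.Im z).
Proof.
by case: z => a b; rewrite /ceigfun /GRing.mul/= !mul0r subr0 addr0.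
Qed.

Lemma compact_support_bound (phi : R -> R[i]) : compact (support phi) ->
  exists M, forall x, M < `|x| -> ~ support phi x.
Proof.
move=> /compact_bounded[M [_ /(_ (M + 1))]].
rewrite ltrDl ltr01 => /(_ isT) KM; exists (M + 1) => x Mx /KM /=.
by rewrite leNgt Mx.
Qed.

Lemma gordon_eigenvalue : H_eigenvalue (@gordon R) (-1).
Proof.
exists ceigfun; split.
  move=> [A [mA A0 sub]].
  have : (lebesgue_measure [set: R] <= lebesgue_measure A)%E.
    rewrite le_measure ?inE//= => x _; apply: sub => /= /eqP.
    rewrite eq_complex/= eqxx andbT; apply/negP.
    by rewrite gt_eqF// eigfun_gt0.
  by rewrite A0 -set_itvNyy lebesgue_measure_itv/= leye_eq.
split.
- exact: ceigfun_L2.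
- exact/L2N1/ceigfun_L2.
- split; [exact: eigfun_continuous|move=> x; exact: cvg_cst].
move=> phi tphi; have [dr di cphi] := tphi.
have [M suppM] := compact_support_bound cphi.
have phiM x : M < `|x| -> phi x = 0 by move=> /suppM /support_notin.
have [N NM] := pos_escape M.
have r0 x : M < `|x| -> re_part phi x = 0 by move=> /phiM; rewrite /re_part => ->.
have i0 x : M < `|x| -> im_part phi x = 0 by move=> /phiM; rewrite /im_part => ->.
have wr := eigfun_weak dr r0 NM; have wi := eigfun_weak di i0 NM.
have sub : support (fun x => ceigfun x * phi x) `<=` support phi.
  apply: closure_subset => x /=; apply: contra_neq => ->; exact: mulr0.
have cs : compact (support (fun x => ceigfun x * phi x)).
  by apply: (subclosed_compact _ cphi sub); exact: closed_closure.
have contn (f : R -> R) n : (forall n x, derivable (derive1n n f) x 1) ->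
    continuous (derive1n n f).
  by move=> df x; apply/differentiable_continuous/derivable1_diffP; exact: df.
have contr := contn _ 0%N dr; have conti := contn _ 0%N di.
have intE f f2 : continuous f -> continuous f2 ->
    (forall x, M < `|x| -> f x = 0) -> (forall x, M < `|x| -> f2 x = 0) ->
    Rintegral leb setT (fun x => - (eigfun x * f x)) =
    - Rintegral leb setT (fun x => eigfun x * f2 x) +
    Rintegral leb setT (fun x => eigfun x * (f2 x - f x)).
  move=> cf cf2 f0 f20.
  have int1 g : continuous g -> (forall x, M < `|x| -> g x = 0) ->
      leb.-integrable setT (EFin \o (fun x => eigfun x * g x)).
    move=> cg g0; apply: (@integrable_csupport _ _ M _ _).1.
      by move=> x; apply: cvgM; [exact: eigfun_continuous|exact: cg].
    by move=> x /g0 ->; rewrite mulr0.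
  have -> : (fun x => eigfun x * (f2 x - f x)) =
      (fun x => eigfun x * f2 x - eigfun x * f x) by apply/funext => x; rewrite mulrBr.
  rewrite RintegralB ?int1// addKr.
  under eq_Rintegral do rewrite -mulN1r.
  by rewrite RintegralZl ?int1// mulN1r.
have lmE : lm_int (@gordon R) (fun x => ceigfun x * phi x) =
    (\sum_(n < N) strength n * (eigfun (pos n) * re_part phi (pos n))) +i*
    (\sum_(n < N) strength n * (eigfun (pos n) * im_part phi (pos n))).
  rewrite (@lm_int_atomic _ _ _ N strength pos)//.
  - rewrite -(sum_complex N (fun n => strength n * (eigfun (pos n) * re_part phi (pos n)))
       (fun n => strength n * (eigfun (pos n) * im_part phi (pos n)))).
    apply: eq_bigr => n _; rewrite ceigfunM.
    by rewrite /GRing.mul/= !mul0r subr0 addr0.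
  - under eq_fun do rewrite ceigfunM.
    apply: measurable_funM; [exact: measurable_eigfun|].
    by apply: continuous_measurable_fun; exact: contr.
  - under eq_fun do rewrite ceigfunM.
    apply: measurable_funM; [exact: measurable_eigfun|].
    by apply: continuous_measurable_fun; exact: conti.
  - by move=> A; apply: gordon_funE => n /NM /suppM nsup [_ /sub].
rewrite lmE /leb_int.
have partE (f : R -> R[i]) : (re_part (fun x => ceigfun x * f x) = fun x => eigfun x * re_part f x)
    /\ (im_part (fun x => ceigfun x * f x) = fun x => eigfun x * im_part f x).
  by split; apply/funext => x; rewrite /re_part /im_part ceigfunM.
have partN (f : R -> R[i]) :
    (re_part (fun x => -1 * ceigfun x * f x) = fun x => - (eigfun x * re_part f x))
    /\ (im_part (fun x => -1 * ceigfun x * f x) = fun x => - (eigfun x * im_part f x)).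
  by split; apply/funext => x; rewrite /re_part /im_part -mulrA ceigfunM mulN1r.
rewrite (partE _).1 (partE _).2 (partN _).1 (partN _).2.
rewrite (intE _ _ contr (contn _ 2%N dr) r0 (derive1_csupport (derive1_csupport r0))).
rewrite (intE _ _ conti (contn _ 2%N di) i0 (derive1_csupport (derive1_csupport i0))).
by rewrite wr wi.
Qed.

End eigenvalue.

(** * Comparison of the measure with its translates *)

Section gap.
Context {R : realType}.
Local Open Scope complex_scope.
Local Notation q := (@scale R).
Local Notation leb := (@lebesgue_measure R).

Lemma clipschitz_parts (u : R -> R[i]) : clipschitz u -> exists2 k, 0 <= k &
  (forall x y, `|re_part u x - re_part u y| <= k * `|x - y|) /\
  (forall x y, `|im_part u x - im_part u y| <= k * `|x - y|).
Proof.
move=> [k uk]; exists `|k|; first exact: normr_ge0.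
have le_k x y : normc (u x - u y) <= `|k| * `|x - y|.
  by apply: le_trans (uk x y) _; rewrite ler_wpM2r// ler_norm.
split=> x y; apply: le_trans (le_k x y);
  rewrite /re_part /im_part; case: (u x) (u y) => a b [c d] /=;
  rewrite -sqrtr_sqr ler_sqrt ?addr_ge0 ?sqr_ge0//.
- by rewrite lerDl sqr_ge0.
- by rewrite lerDr sqr_ge0.
Qed.

Lemma normc_le (z : R[i]) : normc z <= `|complex.Re z| + `|complex.Im z|.
Proof.
case: z => a b /=; rewrite -[leRHS]ger0_norm ?addr_ge0// -sqrtr_sqr ler_sqrt ?sqr_ge0//.
by rewrite sqrrD !real_normK ?num_real// [leRHS]addrAC lerDl mulrn_wge0// mulr_ge0.
Qed.

Lemma normc_ge_parts (z : R[i]) : `|complex.Re z| <= normc z /\ `|complex.Im z| <= normc z.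
Proof.
case: z => a b /=; split; rewrite -sqrtr_sqr ler_sqrt ?addr_ge0 ?sqr_ge0//.
- by rewrite lerDl sqr_ge0.
- by rewrite lerDr sqr_ge0.
Qed.

Lemma lm_int_gap (u : R -> R[i]) (p : R) N : clipschitz u -> compact (support u) ->
  (forall n, (N <= n)%N -> ~ support u (pos n) /\ ~ support u (pos n - p)) ->
  lm_int (lm_sub (@gordon R) (lm_translate gordon p)) u =
  \sum_(n < N) (strength n)%:C * (u (pos n) - u (pos n - p)).
Proof.
move=> /clipschitz_parts[k k0 [ru iu]] cu uN.
(* the atoms of both measures in one sequence of length [N + N] *)
pose w n := if (n < N)%N then strength n else - strength (n - N) : R.
pose z n := if (n < N)%N then pos n else pos (n - N) - p : R.
have wz (V : zmodType) (F : R -> R -> V) : (forall a x, F (- a) x = - F a x) ->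
    \sum_(n < N + N) F (w n) (z n) =
    \sum_(n < N) (F (strength n) (pos n) - F (strength n) (pos n - p)).
  move=> FN; rewrite big_split_ord/= big_split/= ; congr (_ + _); apply: eq_bigr => n _.
    by rewrite /w /z ltn_ord.
  by rewrite /w /z ltnNge leq_addr/= addKn FN.
rewrite (@lm_int_atomic _ _ _ (N + N) w z)//.
- rewrite (wz _ (fun a x => a%:C * u x)); last by move=> a x; rewrite rmorphN mulNr.
  by apply: eq_bigr => n _; rewrite mulrBr.
- by apply: continuous_measurable_fun; exact: lip_continuous k0 ru.
- by apply: continuous_measurable_fun; exact: lip_continuous k0 iu.
move=> A; rewrite (wz _ (fun a x => a * \1_(A `&` support u) x)); last first.
  by move=> a x; rewrite mulNr.
rewrite /= /lm_sub_fun /lm_translate_fun /= shift_setE.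
rewrite (@gordon_funE _ N); last by move=> n /uN[nu _] [].
rewrite (@gordon_funE _ N); last by move=> n /uN[_ nu] [].
by rewrite -rmorphB; congr (_%:C); rewrite -sumrB.
Qed.

Lemma local_norm_test_lip (I : set R) (u : R -> R[i]) : local_norm_test I u ->
  (forall x y, `|re_part u x - re_part u y| <= `|x - y|) /\
  (forall x y, `|im_part u x - im_part u y| <= `|x - y|).
Proof.
move=> [/clipschitz_parts[k k0 [ru iu]] _ _]; rewrite unlock /Lnorm.
have -> : (0 < leb [set: R])%E by rewrite -set_itvNyy lebesgue_measure_itv/= ltry.
move=> /ess_supP du.
have dE x : (abse \o (fun x => (normc (cderive u x))%:E)) x = (normc (cderive u x))%:E.
  by rewrite [LHS]gee0_abs// lee_fin normc_ge0.
split=> x y; rewrite -[leRHS]mul1r; move: x y; apply: lipschitz_ae_derive_le k0 _ _ _ _ => //.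
- apply: (@filterS _ _ (ae_filter_ringOfSetsType leb) _ _ _ du) => x.
  rewrite dE lee_fin; apply: le_trans.
  exact: (normc_ge_parts (cderive u x)).1.
- apply: (@filterS _ _ (ae_filter_ringOfSetsType leb) _ _ _ du) => x.
  rewrite dE lee_fin; apply: le_trans.
  exact: (normc_ge_parts (cderive u x)).2.
Qed.

(** The real and imaginary parts are 1-Lipschitz and vanish at distance 3 from
    any point of the support. *)
Lemma local_norm_test_bound (I : set R) (u : R -> R[i]) : local_norm_test I u ->
  forall x, normc (u x) <= 6.
Proof.
move=> tu; have [ru iu] := local_norm_test_lip tu; have [_ _ du _] := tu.
move=> x; have [ux|nux] := pselect (support u x); last first.
  by rewrite (support_notin nux) normc0.
have ux3 : u (x + 3) = 0.
  apply: support_notin => ux3.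
  have : ((`|x - (x + 3)|)%:E <= 2%:E)%E.
    by apply: le_trans du; apply: ereal_sup_ubound; exists (x, x + 3).
  by rewrite lee_fin opprD addrA subrr sub0r normrN ger0_norm//; lra.
have := ru x (x + 3); have := iu x (x + 3).
rewrite /re_part /im_part ux3 /= !subr0 opprD addrA subrr sub0r normrN (ger0_norm (_ : 0 <= 3))//.
by have := normc_le (u x); lra.
Qed.

Lemma local_norm_test_compact (I : set R) (u : R -> R[i]) (M : R) :
  I `<=` `[- M, M] -> local_norm_test I u -> compact (support u).
Proof.
move=> IM [_ uI _ _]; apply: (subclosed_compact _ (@segment_compact _ (- M) M)).
  exact: closed_closure.
exact: subset_trans IM.
Qed.

Lemma normc_sum n (F : 'I_n -> R[i]) : normc (\sum_(i < n) F i) <= \sum_(i < n) normc (F i).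
Proof.
elim/big_rec2: _ => [|i x y _ yx]; first by rewrite normc0.
by apply: (le_trans (le_normcD _ _)); rewrite lerD2l.
Qed.

Lemma normcMR (a : R) (z : R[i]) : normc (a%:C * z) = `|a| * normc z.
Proof. by rewrite normcM normcR. Qed.

(** For [p = q m.+1], atoms with consecutive digits of order [m] are compared.  The
    atoms of digit 2, and the translates of the atoms of digit -1, have no partner
    but lie outside [[-p, p]]. *)
Lemma gordon_gap_le m :
  (gordon_gap (@gordon R) (q m.+1) <= (expR (- q m.+1 + 19 * q m))%:E)%E.
Proof.
set p := q m.+1; apply: ge_ereal_sup => _ [u tu <-].
have Qm := @scale_leS R m; have Qm4 := @scale_ge4 R m; rewrite -/p in Qm.
have cu := local_norm_test_compact (@subset_refl _ _) tu.
have ub := local_norm_test_bound tu; have [lu uI _ _] := tu.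
have u0 x : p < `|x| -> ~ support u x.
  by move=> px /uI/=; rewrite in_itv/= -ler_norml leNgt px.
have uz x : p < `|x| -> u x = 0 by move=> /u0 /support_notin.
rewrite (lm_int_gap (N := (4 ^ m.+1)%N) lu cu); last first.
  move=> n /(@pos_high R); rewrite -/p; have := @scale_leS R m.+1; rewrite -/p => Q2 far.
  split; apply: u0; first lra.
  by have := lerB_dist (pos n) p; rewrite (ger0_norm (_ : 0 <= p)); lra.
rewrite (sum_block (fun n => (strength n)%:C * (u (pos n) - u (pos n - p)))).
set E := expR (- p + 15 * q m).
have bnd b : (b < 4 ^ m)%N ->
   normc ((strength b)%:C * (u (pos b) - u (pos b - p)) +
     (strength (b + 1 * 4 ^ m))%:C * (u (pos (b + 1 * 4 ^ m)) - u (pos (b + 1 * 4 ^ m) - p)) +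
     (strength (b + 2 * 4 ^ m))%:C * (u (pos (b + 2 * 4 ^ m)) - u (pos (b + 2 * 4 ^ m) - p)) +
     (strength (b + 3 * 4 ^ m))%:C * (u (pos (b + 3 * 4 ^ m)) - u (pos (b + 3 * 4 ^ m) - p)))
   <= 72 * E.
  move=> bm; have yb := @pos_bound R _ _ bm.
  rewrite !pos_block// /sdigit/= !mul1r -/p.
  have -> : pos b + p - p = pos b by lra.
  have -> : pos b + 2 * p - p = pos b + p by lra.
  have -> : pos b + -1 * p = pos b - p by lra.
  rewrite (uz (pos b + 2 * p)); last first.
    by move: yb; rewrite ler_norml => /andP[y1 y2]; rewrite ltr_normr; apply/orP; left; lra.
  rewrite (uz (pos b - p - p)); last first.
    by move: yb; rewrite ler_norml => /andP[y1 y2]; rewrite ltr_normr; apply/orP; right; lra.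
  have S c c' : (c < 4)%N -> (c' < 4)%N -> forall x,
      normc ((strength (b + c * 4 ^ m) - strength (b + c' * 4 ^ m))%:C * u x) <= 24 * E.
    move=> c4 c4' x; rewrite normcMR (_ : 24 * E = (4 * E) * 6); last lra.
    by rewrite ler_pM ?normr_ge0 ?normc_ge0//; exact: strength_shift.
  have := S 0 1 isT isT (pos b); have := S 1 2 isT isT (pos b + p).
  have := S 3 0 isT isT (pos b - p); rewrite mul0n addn0 !rmorphB /=.
  set a0 := (strength b)%:C; set a1 := (strength (b + 1 * 4 ^ m))%:C.
  set a2 := (strength (b + 2 * 4 ^ m))%:C; set a3 := (strength (b + 3 * 4 ^ m))%:C.
  move=> S3 S1 S0.
  have -> : a0 * (u (pos b) - u (pos b - p)) + a1 * (u (pos b + p) - u (pos b)) +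
      a2 * (0 - u (pos b + p)) + a3 * (u (pos b - p) - 0) =
     (a0 - a1) * u (pos b) + (a1 - a2) * u (pos b + p) + (a3 - a0) * u (pos b - p).
    by ring.
  have := le_normcD ((a0 - a1) * u (pos b) + (a1 - a2) * u (pos b + p)) ((a3 - a0) * u (pos b - p)).
  have := le_normcD ((a0 - a1) * u (pos b)) ((a1 - a2) * u (pos b + p)).
  lra.
rewrite lee_fin; apply: (le_trans (normc_sum _)).
apply: (@le_trans _ _ (\sum_(b < 4 ^ m) 72 * E)); first by apply: ler_sum => b _; exact: bnd.
rewrite sumr_const card_ord -[leLHS]mulr_natl natrX.
have q4 : 4 * 4 ^+ m <= q m.
  apply: le_trans (@scale_ge_expn R m); rewrite ler_pM2l//.
  by rewrite lerXn2r// ?nnegrE//; lra.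
have -> : - p + 19 * q m = (- p + 15 * q m) + (2 * q m + 2 * q m) by lra.
rewrite expRD -/E expRD mulrA mulrC; apply: ler_wpM2l; first exact: expR_ge0.
have := expR_ge1Dx (2 * q m); nra.
Qed.

(** The trapezoid of centre [c], half-width [r], height [s] and slopes 1 and -1;
    a tent when [r = s]. *)
Definition trapezoid (c r s x : R) : R := Num.min s (Num.max 0 (r - `|x - c|)).

Lemma trapezoid_lip (c r s x y : R) :
  `|trapezoid c r s x - trapezoid c r s y| <= `|x - y|.
Proof.
rewrite /trapezoid; have h1 := ler_dist_dist (x - c) (y - c).
have xyE : x - c - (y - c) = x - y by lra.
rewrite xyE in h1; apply: le_trans h1.
move: (`|x - c|) (`|y - c|) => a b.
rewrite !minEle !maxEle ler_norml.
have := ler_norm (a - b); have := ler_norm (- (a - b)); rewrite normrN.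
move: (`|a - b|) => d d1 d2.
case: (leP 0 (r - a)) => ?; case: (leP 0 (r - b)) => ?;
  do 2?[case: (leP s _) => ?]; apply/andP; split; lra.
Qed.

Lemma trapezoid_far (c r s x : R) : 0 <= s -> r <= `|x - c| -> trapezoid c r s x = 0.
Proof. by move=> s0 rx; rewrite /trapezoid max_l ?subr_le0// min_r. Qed.

Lemma trapezoid_top (c r s x : R) : 0 <= s -> `|x - c| <= r - s -> trapezoid c r s x = s.
Proof.
move=> s0 rx; have sx : s <= r - `|x - c| by lra.
by rewrite /trapezoid max_r ?min_l//; lra.
Qed.

(** This holds at every point: where the derivative does not exist, [derive1] is 0. *)
Lemma lip1_derive1 (f : R -> R) x :
  (forall x y, `|f x - f y| <= `|x - y|) -> `|derive1 f x| <= 1.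
Proof.
move=> lf; set g := fun h => h^-1 *: (f (h + x) - f x).
have [/cvg_ex[l gl]|ncv] := pselect (cvg (g h @[h --> 0^'])).
  rewrite /derive1 (cvg_lim _ gl)//.
  have nl : `|g h| @[h --> 0^'] --> `|l| by apply: cvg_norm.
  rewrite -(cvg_lim _ nl)//; apply: limr_le; first by apply/cvg_ex; exists `|l|.
  near=> h; have h0 : h != 0 by near: h; exact: nbhs_dnbhs_neq.
  rewrite /g normrZ normfV mulrC ler_pdivrMr ?normr_gt0// mul1r.
  by apply: le_trans (lf _ _) _; rewrite addrK.
rewrite /derive1 -/g (_ : lim _ = 0) ?normr0//.
apply: getPN => l gl.
by apply: ncv; apply/cvg_ex; exists l.
Unshelve. all: by end_near. Qed.

(** The trapezoid as a complex-valued function. *)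
Definition ctrapezoid (c r s : R) (x : R) : R[i] := (trapezoid c r s x)%:C.

Lemma ctrapezoid_test (c r s p : R) : 0 < s -> r <= 1 -> - p <= c - r -> c + r <= p ->
  local_norm_test `[- p, p] (ctrapezoid c r s).
Proof.
move=> s0 r1 cp pc.
have supp x : support (ctrapezoid c r s) x -> `[c - r, c + r]%classic x.
  rewrite (closure_id `[c - r, c + r]%classic).1; last exact: itv_closed.
  move: x; rewrite /support.
  apply: closureS => x /=; apply: contraNP => /negP xr; apply/eqP; congr (_%:C).
  apply: trapezoid_far; first exact: ltW.
  by move: xr; rewrite in_itv/= -ler_distlC distrC -ltNge => /ltW.
split.
- exists 1 => x y; rewrite /ctrapezoid -rmorphB normcR mul1r.
  exact: trapezoid_lip.
- move=> x /supp/=; rewrite !in_itv/= => /andP[x1 x2]; apply/andP; split; lra.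
- apply: ge_ereal_sup => _ [[x y] /= [/supp xs /supp ys] <-].
  move: xs ys; rewrite /= !in_itv/= => /andP[x1 x2] /andP[y1 y2].
  by rewrite lee_fin ler_norml; apply/andP; split; lra.
- rewrite unlock /Lnorm; case: ifP => // _; apply/ess_supP; apply: aeW => x.
  rewrite [X in (X <= _)%E]gee0_abs ?lee_fin ?normc_ge0//.
  rewrite /cderive (_ : im_part _ = cst 0)// derive1_cst.
  rewrite (_ : re_part _ = trapezoid c r s)// normcR.
  by apply: lip1_derive1; exact: trapezoid_lip.
Qed.

(** Lower bound by one trapezoid; the sum is eventually constant in [N]. *)
Lemma gordon_gap_ge (c r s p v : R) N0 :
  0 < s -> r <= 1 -> - p <= c - r -> c + r <= p ->
  (forall N, (N0 <= N)%N -> \sum_(n < N) strength n *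
     (trapezoid c r s (pos n) - trapezoid c r s (pos n - p)) = v) ->
  (`|v|%:E <= gordon_gap (@gordon R) p)%E.
Proof.
move=> s0 r1 cp pc vE; have tt := ctrapezoid_test s0 r1 cp pc.
apply: ereal_sup_ubound; exists (ctrapezoid c r s) => //.
have [N1 N1E] := pos_escape (p + `|p|).
have [lt sI _ _] := tt.
pose N := maxn N0 N1.
have far n : (N <= n)%N -> ~ support (ctrapezoid c r s) (pos n) /\
    ~ support (ctrapezoid c r s) (pos n - p).
  move=> Nn; have /N1E far : (N1 <= n)%N by apply: leq_trans Nn; exact: leq_maxr.
  have big x : p < `|x| -> ~ support (ctrapezoid c r s) x.
    by move=> px /sI/=; rewrite in_itv/= -ler_norml leNgt px.
  have := normr_ge0 p.
  split; apply: big; first lra.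
  by have := lerB_dist (pos n) p; lra.
have cu := local_norm_test_compact (@subset_refl _ _) tt.
rewrite (lm_int_gap (N := N) lt cu far) -(vE N (leq_maxl _ _)).
congr (_%:E); rewrite -normcR; congr normc.
rewrite rmorph_sum; apply: eq_bigr => n _.
by rewrite [RHS]rmorphM [X in _ = _ * X]rmorphB.
Qed.

Lemma pos_separated n n' : n != n' -> 60 <= `|@pos R n - pos n'|.
Proof.
move=> nn'; have := @pos_far R 0 n n'; rewrite expn0 !divn1 => /(_ nn').
by rewrite scaleS scale0; lra.
Qed.

(** A tent at an atom whose translate is at distance at least [d] from all atoms
    sees this atom only. *)
Lemma gap_tent (p d : R) i : 0 < d -> d <= 1 -> `|pos i| + d <= p ->
  (forall n, d <= `|pos n - (pos i + p)|) ->
  ((height i * d)%:E <= gordon_gap (@gordon R) p)%E.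
Proof.
move=> d0 d1 ip far.
have := @gordon_gap_ge (pos i) d d p (strength i * d) i.+1 d0 d1.
have : `|@pos R i| <= p - d by lra.
rewrite ler_norml => /andP[i1 i2].
move=> /(_ ltac:(lra) ltac:(lra)) gap.
apply: le_trans (gap _); last first.
  move=> N iN; rewrite (bigD1 (Ordinal iN))//= big1 ?addr0.
    rewrite trapezoid_top ?subrr ?normr0//; last exact: ltW.
    rewrite trapezoid_far ?subr0//; first exact: ltW.
    by have := far i; congr (d <= `|_|); lra.
  move=> n ni; rewrite !trapezoid_far ?subrr ?mulr0//; [exact: ltW| |exact: ltW|].
    by have := far n; congr (d <= `|_|); lra.
  have := @pos_separated n i ni; lra.
rewrite lee_fin normrM (gtr0_norm d0) ler_wpM2r//; first exact: ltW.
exact: strength_ge_height.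
Qed.

(** A plateau of half-width [1/2] around 0 sees 0 and [q m.+1 - p] at the same
    height. *)
Lemma gap_scale m (p : R) : `|p - q m.+1| <= 2^-1 -> 1 <= p ->
  ((expR (- q m.+1) / 6)%:E <= gordon_gap (@gordon R) p)%E.
Proof.
move=> pq p1; have mE : pos (1 * 4 ^ m) = q m.+1 by rewrite pos_pure// /sdigit/= mul1r.
have := @gordon_gap_ge 0 1 2^-1 p ((strength 0 - strength (1 * 4 ^ m)) * 2^-1) (1 * 4 ^ m).+1.
move=> /(_ ltac:(lra) ltac:(lra) ltac:(lra) ltac:(lra)) gap.
apply: le_trans (gap _); last first.
  move=> N iN; under eq_bigr do rewrite mulrBr.
  rewrite sumrB mulrBl; congr (_ - _).
    have N0 : (0 < N)%N by apply: leq_trans iN.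
    rewrite (bigD1 (Ordinal N0))//= big1 ?addr0.
      by rewrite pos0 trapezoid_top// ?subrr ?normr0; lra.
    move=> n n0; rewrite trapezoid_far ?mulr0//.
    by have := @pos_separated n 0 n0; rewrite pos0; lra.
  rewrite (bigD1 (Ordinal iN))//= big1 ?addr0.
    rewrite trapezoid_top// mE subr0 distrC; lra.
  move=> n nm; rewrite trapezoid_far ?mulr0// subr0.
  have := @pos_separated n (1 * 4 ^ m)%N nm; rewrite mE => far.
  have := lerB_dist (pos n - q m.+1) (p - q m.+1).
  rewrite (_ : pos n - q m.+1 - (p - q m.+1) = pos n - p); last by lra.
  by lra.
rewrite lee_fin normrM (ger0_norm (_ : 0 <= 2^-1))//.
by have := @strength_gap R m; lra.
Qed.

(** The constant 5 absorbs the factor [1 / 6] of the previous lemma and the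
    distance, less than 1, from [p] to a nearby atom. *)
Lemma gordon_gap_lower (p : R) : 10 <= p ->
  ((expR (- p - 5))%:E <= gordon_gap (@gordon R) p)%E.
Proof.
move=> p10; set d := expR (- p).
have d0 : 0 < d by exact: expR_gt0.
have e5 : expR (- p - 5) = d * expR (- 5) by rewrite -expRD.
have e5' : expR (-5) <= 6^-1 :> R.
  rewrite expRN lef_pV2 ?posrE ?expR_gt0//.
  by have := expR_ge1Dx (5 : R); lra.
have d2 : d <= 2^-1.
  rewrite /d expRN lef_pV2 ?posrE ?expR_gt0//.
  by have := expR_ge1Dx p; lra.
have [[n nd]|far] := pselect (exists n, `|@pos R n - p| < d); last first.
  apply: le_trans (gap_tent (i := 0) d0 _ _ _); last 3 first.
  - by lra.
  - by rewrite pos0 normr0; lra.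
  - move=> n; rewrite pos0 add0r leNgt; apply/negP => nd; apply: far; exists n.
    exact: nd.
  by rewrite height0 mul1r lee_fin e5; nra.
have /andP[n1 n2] : (p - d < pos n < p + d) by rewrite -ltr_distl.
have [[m nE]|[i [ip hi far]]] := @shift_witness R n ltac:(lra).
  have nq : pos n = q m.+1 by rewrite nE -[(4 ^ m)%N]mul1n pos_pure// /sdigit/= mul1r.
  apply: le_trans (gap_scale (m := m) _ _); [|by rewrite -nq distrC; lra|lra].
  rewrite lee_fin -nq.
  have : expR (- p - 1) <= expR (- pos n) by rewrite ler_expR; lra.
  have -> : expR (- p - 5) = expR (- p - 1) * expR (- 4) by rewrite -expRD; congr expR; lra.
  move=> h; apply: ler_pM; rewrite ?expR_ge0//.
  rewrite expRN lef_pV2 ?posrE ?expR_gt0//.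
  have -> : 4 = 2 + 2 :> R by lra.
  by rewrite expRD; have := expR_ge1Dx (2 : R); nra.
apply: le_trans (gap_tent (i := i) (d := 2^-1) _ _ _ _); [|by []|by lra|by lra|].
  rewrite lee_fin e5; have : d <= height i.
    by apply: le_trans hi; rewrite ler_expR; lra.
  nra.
move=> n'; have := far n'.
have := lerB_dist (pos n' - (pos i + pos n)) (p - pos n).
have := ler_normB (pos n' - (pos i + p)) (pos n - p).
rewrite (_ : pos n' - (pos i + p) - (pos n - p) = pos n' - (pos i + pos n)); last by lra.
lra.
Qed.

End gap.

(** * Conclusion *)

Section conclusion.
Context {R : realType}.
Local Notation q := (@scale R).
Local Notation gap := (gordon_gap (@gordon R)).

Lemma gordon_weak (C : R) : (0 < C)%R -> (C < 1)%R -> weak_gordon (@gordon R) C.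
Proof.
move=> C0 C1; exists (fun m => q m.+1); split.
- by move=> m; exact: scale_gt0.
- apply/cvgryPge => A; near=> m; apply: (@le_trans _ _ m%:R).
    by near: m; exact: nbhs_infty_ger.
  by apply: le_trans (@scale_ge_nat R m) _; exact: scale_mono.
have em : ((fun m => (expR (- m%:R))%:E : \bar R) @ \oo --> 0%E)%classic.
  by apply: cvg_EFin; [exact: nearW|exact: cvgn_expR].
suff sq : (\forall m \near \oo, (0 <= (expR (C * q m.+1))%:E * gap (q m.+1) <=
    (expR (- m%:R))%:E)%E)%classic by exact: (squeeze_cvge sq (cvg_cst _) em).
near=> m.
have Qm := @scale_leS R m; have Qm4 := @scale_ge4 R m.
have mC : (20 / (1 - C) <= m%:R)%R by near: m; exact: nbhs_infty_ger.
have mq : (10 <= q m.+1)%R by lra.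
apply/andP; split.
  rewrite mule_ge0 ?lee_fin ?expR_ge0//; apply: le_trans (gordon_gap_lower mq).
  by rewrite lee_fin expR_ge0.
apply: (@le_trans _ _ ((expR (C * q m.+1))%:E * (expR (- q m.+1 + 19 * q m))%:E)%E).
  by rewrite lee_pmul2l ?lte_fin ?expR_gt0//; exact: gordon_gap_le.
rewrite -EFinM -expRD lee_fin ler_expR.
rewrite ler_pdivrMr ?subr_gt0// in mC.
have := @scale_ge_nat R m; rewrite scaleS; nra.
Unshelve. all: by end_near. Qed.

Lemma gordon_Cmu : Cmu (@gordon R) = 1%E.
Proof.
rewrite /Cmu /limf_einf oppeK; apply/eqP; rewrite eq_le; apply/andP; split.
- apply/lee_addgt0Pr => e e0.
  pose B : R := Num.max 10 (5 / e); pose V := [set p : R | B < p].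
  apply: (@le_trans _ _ (ereal_sup ((fun p : R => - (p^-1%:E * lne (gap p)))%E @` V))).
    apply: ereal_inf_lbound; exists V => //; exists B; split => //; exact: num_real.
  apply: ge_ereal_sup => _ [p /= Bp <-].
  have p10 : 10 < p by apply: le_lt_trans Bp; rewrite le_max lexx.
  have pe : 5 / e < p by apply: le_lt_trans Bp; rewrite le_max lexx orbT.
  have p0 : 0 < p by lra.
  have low : ((- p - 5)%:E <= lne (gap p))%E.
    rewrite -[X in (X%:E <= _)%E]expRK -lne_EFin ?expR_gt0//.
    have low := gordon_gap_lower (ltW p10).
    rewrite lee_lne// in_itv/= leey andbT ?lee_fin ?expR_ge0//.
    by apply: le_trans low; rewrite lee_fin expR_ge0.
  rewrite leeNl; apply: (@le_trans _ _ (p^-1%:E * (- p - 5)%:E)%E); last first.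
    by rewrite lee_pmul2l// lte_fin invr_gt0.
  rewrite -EFinD -EFinN -EFinM lee_fin mulrBr mulrN mulVf ?gt_eqF//.
  have : p^-1 * 5 <= e by rewrite ler_pdivrMl// mulrC -ler_pdivrMl// mulrC ltW.
  lra.
apply: le_ereal_inf_tmp => _ [V [B [_ BV]] <-].
apply/lee_subgt0Pr => e e0.
near \oo => m.
have Bm : B < q m.+1.
  apply: (@lt_le_trans _ _ m%:R); first by near: m; exact: nbhs_infty_gtr.
  by apply: le_trans (@scale_ge_nat R m) _; exact: scale_mono.
have em : 19 / e <= m%:R by near: m; exact: nbhs_infty_ger.
have Q0 := @scale_gt0 R m.+1; have Qm := @scale_leS R m; have Qm4 := @scale_ge4 R m.
apply: (@le_trans _ _ (- ((q m.+1)^-1%:E * lne (gap (q m.+1))))%E); last first.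
  by apply: ereal_sup_ubound; exists (q m.+1) => //; exact: BV.
have gap0 : (0 <= gap (q m.+1))%E.
  apply: le_trans (gordon_gap_lower (_ : 10 <= q m.+1)); last lra.
  by rewrite lee_fin expR_ge0.
have up : (lne (gap (q m.+1)) <= (- q m.+1 + 19 * q m)%:E)%E.
  rewrite -[X in (_ <= X%:E)%E]expRK -lne_EFin ?expR_gt0//.
  by rewrite lee_lne ?gordon_gap_le// in_itv/= leey andbT ?lee_fin ?expR_ge0.
rewrite leeNr; apply: (@le_trans _ _ ((q m.+1)^-1%:E * (- q m.+1 + 19 * q m)%:E)%E).
  by rewrite lee_pmul2l// lte_fin invr_gt0.
rewrite -EFinB -EFinN -EFinM lee_fin mulrDr mulrN mulVf ?gt_eqF//.
have : (q m.+1)^-1 * (19 * q m) <= e.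
  rewrite ler_pdivrMl// scaleS; rewrite ler_pdivrMr// in em.
  have : 0 <= e * q m by rewrite mulr_ge0; lra.
  have : 19 * q m <= (m%:R * e) * q m by rewrite ler_wpM2r//; lra.
  lra.
lra.
Unshelve. all: by end_near. Qed.

Lemma gordon_Emu : Emu (@gordon R) = 1%E.
Proof. by rewrite /Emu gordon_Cmu gordon_inf_unif sube0 expe2 mule1. Qed.

End conclusion.

Theorem mainTheorem4 (R : realType) :
  exists mu : local_measure R,
    [/\ in_Mlocunif mu,
        H_eigenvalue mu (-1),
        (forall C : R, 0 < C -> C < 1 -> weak_gordon mu C) &
        inf_unif_normr mu = 0%E] /\
    (Cmu mu = 1%E /\ Emu mu = 1%E).
Proof.
exists gordon; split; last by split; [exact: gordon_Cmu|exact: gordon_Emu].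
split; [exact: gordon_unif|exact: gordon_eigenvalue|exact: gordon_weak|exact: gordon_inf_unif].
Qed.
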